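(* There is an absolute constant $c_0$ such that for every $k\ge3$, $n=k^2$, and every $H_n\in\mathcal H_n$, $\mathrm{FIX}(H_n)\le c_0\,n/\log n$; i.e., $\mathrm{FIX}(H_n)=O(n/\log n)$.
   Context: For $k\ge3$ and $n=k^2$, $\mathcal H_n$ is the set of all 3-connected planar graphs obtainable as follows: draw $k$ triangulations (maximal plane graphs), each with $k$ vertices, so that none of them lies inside an inner face of any other, and add further edges between them so that the whole graph is 3-connected. A drawing of a planar graph $G$ is an injective map $\pi\colon V(G)\to\mathbb{R}^2$ with edges drawn as straight segments; a plane straight line drawing is one whose edge segments meet only at common endpoints and contain no other vertex images. $\mathrm{fix}(G,\pi)$ is the maximum over plane straight line drawings $\pi'$ of $|\{v:\pi'(v)=\pi(v)\}|$; for $X$ with $|X|=|V(G)|$, $\mathrm{fix}_X(G)=\min\{\mathrm{fix}(G,\pi):\pi(V(G))=X\}$; $\mathrm{FIX}(G)=\max_X\mathrm{fix}_X(G)$ over all $|V(G)|$-point sets $X$ in the plane. *)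

(* Defs.v *)
From HB Require Import structures.
From mathcomp Require Export all_boot all_order all_algebra.
From mathcomp Require Export all_classical all_reals all_analysis.
Export Order.TTheory GRing.Theory Num.Theory.
Export numFieldNormedType.Exports.

Set Implicit Arguments.
Unset Strict Implicit.
Unset Printing Implicit Defensive.

Local Open Scope classical_set_scope.
Local Open Scope ring_scope.

Notation plane R := (R^o * R^o)%type.

Definition segment (R : realType) (a b : plane R) : set (plane R) :=
  [set p | exists2 t : R, 0 <= t <= 1 & p = (1 - t) *: a + t *: b].

Definition simple_graph (T : finType) (e : rel T) : Prop :=
  symmetric e /\ irreflexive e.

Definition del_verts (T : finType) (e : rel T) (S : {set T}) : rel T :=
  [rel u v | [&& e u v, u \notin S & v \notin S]].

Definition k_connected (k : nat) (T : finType) (e : rel T) : Prop :=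
  (k < #|T|)%N /\
  forall S : {set T}, (#|S| < k)%N ->
    forall u v, u \notin S -> v \notin S -> connect (del_verts e S) u v.

Definition induced (T : finType) (e : rel T) (V : {set T}) :
    rel {x : T | x \in V} :=
  relpre val e.
Arguments induced [T] e V _ _.

Definition restrict_drawing (R : realType) (T : finType) (pi : T -> plane R)
    (V : {set T}) : {x : T | x \in V} -> plane R :=
  pi \o val.
Arguments restrict_drawing [R T] pi V _.

Definition figure (R : realType) (T : finType) (e : rel T)
    (pi : T -> plane R) : set (plane R) :=
  [set p | (exists v, p = pi v) \/
           (exists u v, e u v /\ segment (pi u) (pi v) p)].

Definition plane_drawing (R : realType) (T : finType) (e : rel T)
    (pi : T -> plane R) : Prop :=
  [/\ injective pi,
      forall u v w, e u v -> segment (pi u) (pi v) (pi w) ->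
        w \in [set u; v]%SET
    & forall u v x y, e u v -> e x y -> [set u; v]%SET != [set x; y]%SET ->
        forall p, segment (pi u) (pi v) p -> segment (pi x) (pi y) p ->
        exists2 w, w \in ([set u; v] :&: [set x; y])%SET & p = pi w].

Definition arc (R : realType) (a b : plane R) (g : R -> plane R) : Prop :=
  [/\ {within `[0, 1], continuous g}, {in `[0, 1] &, injective g},
      g 0 = a & g 1 = b].

(* The edge that cannot be added may be any arc, not only a segment: a
   straight-line plane graph that is maximal with respect to segments is just a
   geometric triangulation of a point set, whose outer face need not be a
   triangle. *)
Definition maximal_plane (R : realType) (T : finType) (e : rel T)
    (pi : T -> plane R) : Prop :=
  plane_drawing e pi /\
  forall u v, u != v -> ~~ e u v ->
    ~ exists2 g, arc (pi u) (pi v) g &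
        forall t, 0 < t < 1 -> ~ figure e pi (g t).

Definition face (R : realType) (T : finType) (e : rel T)
    (pi : T -> plane R) (F : set (plane R)) : Prop :=
  exists2 x, ~ figure e pi x & F = connected_component (~` figure e pi) x.

Definition inner_face (R : realType) (T : finType) (e : rel T)
    (pi : T -> plane R) (F : set (plane R)) : Prop :=
  face e pi F /\ bounded_set F.

(* The blocks of the vertex partition carry the k triangulations. As the other
   edges only join different blocks, the i-th triangulation is the subgraph
   induced by the i-th block. Drawings are straight-line; by Fary's theorem,
   curved edges would give the same class of graphs. *)
Definition in_Hn (R : realType) (k : nat) (T : finType) (e : rel T) : Prop :=
  [/\ simple_graph e, k_connected 3 e &
      exists (block : 'I_k -> {set T}) (pi : T -> plane R),
      [/\ plane_drawing e pi,
          forall v, exists! i, v \in block i,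
          forall i, #|block i| = k,
          forall i, maximal_plane (induced e (block i)) (restrict_drawing pi (block i))
        & forall i j, i != j -> forall F,
            inner_face (induced e (block i)) (restrict_drawing pi (block i)) F ->
            ~ (figure (induced e (block j)) (restrict_drawing pi (block j)) `<=` F)]].

Definition fix_drawing (R : realType) (T : finType) (e : rel T)
    (pi : T -> plane R) : nat :=
  \max_(A : {set T} |
     `[< exists2 pi' : T -> plane R, plane_drawing e pi' &
           A = [set v | pi' v == pi v]%SET >]) #|A|.

(* All values involved are at most #|T|, so the extrema over infinite families
   of drawings and of point sets are taken over the attained values m <= #|T|;
   #|T| is then a harmless default for the minimum. *)
Definition fix_points (R : realType) (T : finType) (e : rel T)
    (X : set (plane R)) : nat :=
  \big[minn/#|T|]_(m < #|T|.+1 |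
     `[< exists pi : T -> plane R,
           [/\ injective pi, range pi = X & fix_drawing e pi = m] >]) m.

Definition FIX (R : realType) (T : finType) (e : rel T) : nat :=
  \max_(m < #|T|.+1 |
     `[< exists2 X : set (plane R), (X #= `I_#|T|)%card & fix_points e X = m >]) m.

(* Main.v *)
(* Each triangulated block is so rigid that in every straight-line plane drawing
   it lies in a triangle spanned by three of its own vertices. This uses only two
   facts that do not depend on the drawing: deleting at most two vertices leaves
   the block connected, and so does deleting one vertex from the neighbourhood of
   a vertex. In the given drawing both follow from maximality (neighbours of [v]
   that are consecutive around [v] are adjacent, and every vertex that is not
   highest in a direction has a neighbour higher in that direction); in an
   arbitrary drawing they make the two extreme neighbours of an extreme vertex
   adjacent, and the triangle so obtained contains the block.

   Edges of different blocks do not cross, so the [k] triangles form a laminar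
   family, and the block of a fixed vertex is that of the innermost triangle
   containing it. Half-planes cut the [n] given points in at most [(n + 1) ^ 3]
   ways, so the [k] triangles cut them in only [2 ^ O(n)] ways. A union bound over
   these cuts and over the sets of [m] fixed points gives a bijection for which
   fewer than [m] vertices can be fixed, as soon as [m] is of order [n / log n]. *)

Require Import Defs.
From mathcomp Require Import all_boot all_order all_algebra.
From mathcomp Require Import all_classical all_reals all_analysis.
From mathcomp Require Import fingroup perm ring lra zify.
Local Open Scope ring_scope.
Set Implicit Arguments.
Unset Strict Implicit.
Unset Printing Implicit Defensive.

(** The drawings that compete in [fix_drawing] are arbitrary and need not have the faces of the
    drawing in [in_Hn], so maximality of the latter says nothing about them directly. Only facts
    about adjacency carry over, hence the detour through [joined], [two_joined] and
    [link_connected]. The order of [m] comes from comparing two quantities. A random bijection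
    places a vertex of a prescribed block at a given point with probability [1 / k], so [m]
    prescribed hits gain a factor of about [k ^ m], which is [n ^ (m / 2)]. Against this stand the
    tables that predict a block for each point: O(k log n) bits for the half-planes, [k * k = n]
    bits for the nesting of the triangles, and [n] further bits for the set of hits. Storing the
    nesting as an arbitrary relation on the blocks is generous, but it costs no more than the set of
    hits does. *)

Lemma ex_argmin (R : realFieldType) (T : finType) (P : T -> Prop) (F : T -> R) :
  (exists x, P x) -> exists2 x, P x & forall y, P y -> F x <= F y.
Proof.
move=> [x0 /asboolP Px0].
case: (@arg_minP _ _ _ x0 (fun x => `[< P x >]) F Px0) => x /asboolP Px xmin.
by exists x => // y /asboolP; exact: xmin.
Qed.

Lemma ex_lexmin (R : realFieldType) (T : finType) (P : T -> Prop) (F G : T -> R) :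
  (exists x, P x) -> exists2 x, P x &
    forall y, P y -> F x < F y \/ (F x = F y /\ G x <= G y).
Proof.
move=> /(ex_argmin F) [x Px xmin].
have [|y [Py Fy] ymin] := @ex_argmin R T (fun y => P y /\ F y = F x) G.
  by exists x.
exists y => // z Pz; rewrite Fy.
have := xmin _ Pz; rewrite le_eqVlt => /orP[/eqP Fz|]; last by left.
by right; split=> //; apply: ymin.
Qed.

(** * Planar drawings in coordinates and their affine images *)

Definition on_seg (R : realFieldType) (V : finType) (X Y : V -> R) (u v : V)
    (p q : R) : Prop :=
  exists2 t : R, 0 <= t <= 1 &
    p = (1 - t) * X u + t * X v /\ q = (1 - t) * Y u + t * Y v.

Record planar (R : realFieldType) (V : finType) (e : rel V) (X Y : V -> R) : Prop :=
  Planar {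
    planar_inj : forall u v, X u = X v -> Y u = Y v -> u = v;
    planar_vertex : forall u v w, e u v -> on_seg X Y u v (X w) (Y w) ->
      w = u \/ w = v;
    planar_cross : forall u v x y p q, e u v -> e x y ->
      on_seg X Y u v p q -> on_seg X Y x y p q ->
      [\/ u = x /\ v = y, u = y /\ v = x
        | exists w, [/\ w = u \/ w = v, w = x \/ w = y, p = X w & q = Y w]] }.

Definition blocked (R : realFieldType) (V : finType) (e : rel V) (X Y : V -> R)
    (p q : R) : Prop :=
  (exists w, p = X w /\ q = Y w) \/ (exists x y, e x y /\ on_seg X Y x y p q).

Definition saturated (R : realFieldType) (V : finType) (e : rel V)
    (X Y : V -> R) : Prop :=
  forall u v, u <> v -> ~~ e u v ->
    exists2 t : R, 0 < t < 1 &
      blocked e X Y ((1 - t) * X u + t * X v) ((1 - t) * Y u + t * Y v).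

Definition strictly_extreme (R : realFieldType) (V : finType) (X Y : V -> R)
    (u : V) : Prop :=
  exists f g : R, forall x, x <> u -> f * X x + g * Y x < f * X u + g * Y u.

(** Segments cannot detect this part of maximality: a triangulated convex polygon is [saturated].
    Bent arcs outside the convex hull supply it. *)
Definition extreme_adjacent (R : realFieldType) (V : finType) (e : rel V)
    (X Y : V -> R) : Prop :=
  forall u v, u <> v -> strictly_extreme X Y u -> strictly_extreme X Y v -> e u v.

(** One coordinate of an affine image of the drawing. Two such functions form again a pair of
    coordinates, so a configuration can be put in normal position before computing. *)
Definition affine (R : realFieldType) (V : finType) (a b c : R) (X Y : V -> R)
    (u : V) : R := a * X u + b * Y u + c.

Lemma affine_inj (R : realFieldType) (a b c d p q p' q' : R) :
  a * d - b * c != 0 -> a * p + b * q = a * p' + b * q' ->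
  c * p + d * q = c * p' + d * q' -> p = p' /\ q = q'.
Proof.
move=> D E1 E2; split; apply: (mulfI D).
  have -> : (a * d - b * c) * p = d * (a * p + b * q) - b * (c * p + d * q) by ring.
  by rewrite E1 E2; ring.
have -> : (a * d - b * c) * q = a * (c * p + d * q) - c * (a * p + b * q) by ring.
by rewrite E1 E2; ring.
Qed.

Lemma on_seg_affine (R : realFieldType) (V : finType) (X Y : V -> R)
    (a b c d k l : R) (u v : V) (p q : R) :
  a * d - b * c != 0 ->
  on_seg (affine a b k X Y) (affine c d l X Y) u v (a * p + b * q + k) (c * p + d * q + l)
  <-> on_seg X Y u v p q.
Proof.
move=> D; split=> -[t t01 [E1 E2]]; exists t => //.
  apply: (affine_inj D); rewrite /affine in E1 E2.
    by apply: (addIr k); rewrite E1; ring.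
  by apply: (addIr l); rewrite E2; ring.
by rewrite /affine E1 E2; split; ring.
Qed.

Lemma ex_preimage_affine (R : realFieldType) (a b c d k l p q : R) :
  a * d - b * c != 0 ->
  exists p' q', p = a * p' + b * q' + k /\ q = c * p' + d * q' + l.
Proof.
move=> D; exists ((d * (p - k) - b * (q - l)) / (a * d - b * c)).
exists ((a * (q - l) - c * (p - k)) / (a * d - b * c)).
by split; field.
Qed.

Lemma planar_affine (R : realFieldType) (V : finType) (e : rel V) (X Y : V -> R)
    (a b c d k l : R) :
  a * d - b * c != 0 -> planar e X Y ->
  planar e (affine a b k X Y) (affine c d l X Y).
Proof.
move=> D pl; split.
- move=> u v /addIr E1 /addIr E2.
  by have [] := affine_inj D E1 E2; exact: (planar_inj pl).
- move=> u v w euv /(on_seg_affine X Y k l u v _ _ D); exact: (planar_vertex pl).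
- move=> u v x y p q euv exy.
  have [p' [q' [-> ->]]] := ex_preimage_affine k l p q D.
  move=> /(on_seg_affine X Y k l _ _ _ _ D) s1 /(on_seg_affine X Y k l _ _ _ _ D) s2.
  case: (planar_cross pl euv exy s1 s2) => [h|h|[w [h1 h2 -> ->]]].
  + exact: Or31.
  + exact: Or32.
  + by apply: Or33; exists w.
Qed.

Lemma saturated_affine (R : realFieldType) (V : finType) (e : rel V) (X Y : V -> R)
    (a b c d k l : R) :
  a * d - b * c != 0 -> saturated e X Y ->
  saturated e (affine a b k X Y) (affine c d l X Y).
Proof.
move=> D sat u v uv /(sat _ _ uv) [t t01 bl]; exists t => //.
have -> : (1 - t) * affine a b k X Y u + t * affine a b k X Y v =
  a * ((1 - t) * X u + t * X v) + b * ((1 - t) * Y u + t * Y v) + k.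
  by rewrite /affine; ring.
have -> : (1 - t) * affine c d l X Y u + t * affine c d l X Y v =
  c * ((1 - t) * X u + t * X v) + d * ((1 - t) * Y u + t * Y v) + l.
  by rewrite /affine; ring.
case: bl => [[w [-> ->]]|[x [y [exy s]]]]; first by left; exists w.
by right; exists x, y; split=> //; apply/on_seg_affine.
Qed.

Lemma extreme_adjacent_affine (R : realFieldType) (V : finType) (e : rel V)
    (X Y : V -> R) (a b c d k l : R) :
  extreme_adjacent e X Y ->
  extreme_adjacent e (affine a b k X Y) (affine c d l X Y).
Proof.
move=> ext; have se u : strictly_extreme (affine a b k X Y) (affine c d l X Y) u ->
    strictly_extreme X Y u.
  move=> [f [g fg]]; exists (f * a + g * c), (f * b + g * d) => x /fg.
  by rewrite /affine; lra.
by move=> u v uv /se su /se sv; apply: ext.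
Qed.

(** * Visibility in saturated drawings *)

Lemma on_seg_sub (R : realFieldType) (V : finType) (X Y : V -> R) (r s : V)
    (p q l : R) : on_seg X Y r s p q -> 0 <= l <= 1 ->
  on_seg X Y r s (p + l * (X r - p)) (q + l * (Y r - q)).
Proof.
move=> [t t01 [-> ->]] l01; exists (t * (1 - l)); last by split; ring.
by apply/andP; split; nra.
Qed.

Lemma on_segC (R : realFieldType) (V : finType) (X Y : V -> R) (r s : V)
    (p q : R) : on_seg X Y r s p q -> on_seg X Y s r p q.
Proof.
by move=> [t t01 [-> ->]]; exists (1 - t); [lra | split; ring].
Qed.

(** Moving from [(x, y)] towards [r] one stays on the low side of the ray through [(xw, yw)], so the
    triangle with corners [(0, 0)], [(1, 0)], [(0, 1)] can be left only through its base or its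
    hypotenuse. The last three hypotheses exclude both, and also an end inside. *)
Lemma exit_low_side (R : realFieldType) (V : finType) (X Y : V -> R) (r s : V)
    (x y xw yw : R) :
  on_seg X Y r s x y -> x * yw = y * xw -> 0 < y -> x + y < 1 ->
  0 <= xw -> 0 < yw -> 0 < X r * yw - Y r * xw ->
  (0 < Y r -> X r + Y r <= 1 -> False) ->
  (forall p : R, 0 < p <= 1 -> on_seg X Y r s p 0 -> False) ->
  (forall p q : R, 0 < p -> 0 < q -> p + q = 1 -> on_seg X Y r s p q -> False) ->
  False.
Proof.
move=> o xy y0 xy1 xw0 yw0 Dr notin h0 h1.
have Dl l : (x + l * (X r - x)) * yw - (y + l * (Y r - y)) * xw =
    l * (X r * yw - Y r * xw).
  by transitivity ((1 - l) * (x * yw - y * xw) + l * (X r * yw - Y r * xw));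
    [ring | rewrite xy; ring].
have exit1 l0 : 0 < l0 <= 1 -> 0 <= y + l0 * (Y r - y) ->
    1 < x + y + l0 * (X r + Y r - (x + y)) -> False.
  move=> l01 Yl0 gt1.
  have ds : 0 < X r + Y r - (x + y).
    by clear -l01 gt1 xy1; nra.
  pose l := (1 - (x + y)) / (X r + Y r - (x + y)).
  have lE : l * (X r + Y r - (x + y)) = 1 - (x + y) by rewrite /l mulfVK // gt_eqF.
  have l_gt0 : 0 < l by apply: divr_gt0; clear -xy1 ds; lra.
  have ll0 : l < l0.
    by rewrite /l ltr_pdivrMr //; clear -gt1; lra.
  have Yl : 0 < y + l * (Y r - y) by clear -l_gt0 ll0 y0 Yl0; nra.
  apply: (h1 _ _ _ Yl _ (on_seg_sub o (l := l) _)); last by clear -l_gt0 ll0 l01; lra.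
  - have := Dl l; have := mulr_gt0 l_gt0 Dr; clear -Yl xw0 yw0; nra.
  - by clear -lE; lra.
have [Yr|Yr] := lerP (Y r) 0.
  have l_gt0 : 0 < y / (y - Y r) by apply: divr_gt0; clear -Yr y0; lra.
  move: l_gt0; set l := y / (y - Y r) => l_gt0.
  have lE : l * (y - Y r) = y by rewrite /l mulfVK // gt_eqF //; clear -Yr y0; lra.
  have l1 : l <= 1 by rewrite /l ler_pdivrMr; clear -Yr y0; lra.
  have Y0 : y + l * (Y r - y) = 0 by clear -lE; lra.
  have X0 : 0 < x + l * (X r - x).
    by have := Dl l; have := mulr_gt0 l_gt0 Dr; rewrite Y0; clear -yw0; nra.
  have [X1|X1] := lerP (x + l * (X r - x)) 1.
    apply: (h0 (x + l * (X r - x))); first by rewrite X0.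
    by rewrite -Y0; apply: on_seg_sub => //; clear -l_gt0 l1; lra.
  by apply: (exit1 l); clear -l_gt0 l1 Y0 X1; lra.
have [S1|S1] := lerP (X r + Y r) 1; first exact: notin.
by apply: (exit1 1); clear -Yr S1; lra.
Qed.

(** An edge that runs along the line [z w] over a point between [z] and [w] has no end between them,
    hence contains both; planarity then makes it the edge [z w]. *)
Lemma collinear_obstacle (R : realFieldType) (V : finType) (e : rel V)
    (X Y : V -> R) (z w r s : V) (m n : R) :
  planar e X Y -> X z = 0 -> Y z = 0 -> ~~ e z w -> w <> z -> 0 < Y w ->
  (forall u, X u * Y w = X w * Y u -> 0 < Y u < Y w -> False) ->
  e r s -> on_seg X Y r s m n -> 0 < n < Y w ->
  X r * Y w = X w * Y r -> X s * Y w = X w * Y s -> Y r < n -> False.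
Proof.
move=> pl Xz Yz nzw wz Yw tie ers [t t01 [_ En]] n0 Er Es Yr.
have Ys : n <= Y s.
  by have [sr|sr] := ltrP (Y r) (Y s); move: Yr; rewrite En; clear -sr t01; nra.
have Xs : X s = X w / Y w * Y s by rewrite mulrAC -Es mulfK // lt0r_neq0.
have Xr : X r = X w / Y w * Y r by rewrite mulrAC -Er mulfK // lt0r_neq0.
have [Yr0|Yr0] := ltrP 0 (Y r).
  by apply: (tie r Er); clear -Yr0 Yr n0; lra.
have sr0 : 0 < Y s - Y r by clear -Ys Yr; lra.
have : z = r \/ z = s.
  apply: (planar_vertex pl ers); exists (- Y r / (Y s - Y r)).
    apply/andP; split; first by apply: divr_ge0; clear -Yr0 sr0; lra.
    by rewrite ler_pdivrMr //; clear -Ys n0; lra.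
  by rewrite Xz Yz Xs Xr; clear -sr0 Yw; split; field; rewrite ?lt0r_neq0.
case=> E; last by subst s; clear -Yz Ys n0; lra.
subst r; have [Yw1|Yw1|Yw1] := ltgtP (Y s) (Y w).
- by apply: (tie s Es); clear -Ys n0 Yw1; lra.
- have Ys0 : 0 < Y s by clear -Yw Yw1; lra.
  have : w = z \/ w = s.
    apply: (planar_vertex pl ers); exists (Y w / Y s).
      by apply/andP; split; [apply: divr_ge0|rewrite ler_pdivrMr //]; clear -Yw Yw1; lra.
    by rewrite Xz Yz Xs; clear -Ys0 Yw; split; field; rewrite ?lt0r_neq0.
  by case=> // E; subst s; clear -Yw1; lra.
- have Es2 : s = w.
    by apply: (planar_inj pl) => //; apply: (mulIf (lt0r_neq0 Yw)); rewrite Es Yw1.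
  by subst s; rewrite ers in nzw.
Qed.

(* The point [(1, 0)] is the first obstacle met from the origin [z] along the axis,
   and it lies inside the edge [p q]; the vertex of the triangle [z], [(1, 0)], [q]
   that is seen from [z] under the least angle is then visible from [z]. *)
Lemma visible_vertex (R : realFieldType) (V : finType) (e : rel V) (X Y : V -> R)
    (z p q : V) :
  symmetric e -> planar e X Y -> saturated e X Y ->
  X z = 0 -> Y z = 0 -> X q = 0 -> Y q = 1 -> e p q -> on_seg X Y p q 1 0 ->
  (forall w (t : R), 0 < t <= 1 -> X w = t -> Y w = 0 -> False) ->
  (forall r s (t : R), e r s -> 0 < t < 1 -> on_seg X Y r s t 0 -> False) ->
  exists w, [/\ e z w, w <> z, 0 <= X w & 0 <= Y w].
Proof.
move=> esym pl sat Xz Yz Xq Yq epq cpq nov noe.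
have [tau tau01 [Xp Yp]] := cpq; rewrite Xq Yq in Xp Yp.
have tau1 : tau < 1.
  by rewrite lt_neqAle (andP tau01).2 andbT; apply/eqP => E; rewrite E in Xp; lra.
have Yp0 : Y p <= 0 by nra.
have Xp0 : 0 < X p by nra.
have Epq : X p + Y p = 1.
  have : (1 - tau) * (X p + Y p - 1) = 0 by lra.
  by move/eqP; rewrite mulf_eq0 => /orP[/eqP|/eqP]; lra.
have onpq (x y : R) : 0 < x -> 0 <= y -> x + y = 1 -> on_seg X Y p q x y.
  move=> x0 y0 xy; exists (1 - x * (1 - tau)); first by apply/andP; split; nra.
  by rewrite Xq Yq; split; nra.
(* An edge through the base or the hypotenuse meets the edge [p q], unless [nov] or [noe] already
   applies. Sharing only a vertex is impossible at such a point, and being [p q] is refuted by a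
   point with [m1 + m2 < 1], as [p q] lies on the line [x + y = 1]. *)
have hit0 r s (x : R) : e r s -> 0 < x <= 1 -> on_seg X Y r s x 0 ->
    (exists m1 m2, on_seg X Y r s m1 m2 /\ m1 + m2 < 1) -> False.
  move=> ers /andP[x0 x1] ox [m1 [m2 [om mlt]]].
  move: x1; rewrite le_eqVlt => /orP[/eqP x1|x1]; last first.
    by apply: (noe r s x) => //; apply/andP.
  subst x; case: (planar_cross pl epq ers cpq ox) => [[E1 E2]|[E1 E2]|[w [_ _ E1 E2]]].
  - by subst r s; case: om => t t01 [Em1 Em2]; rewrite Xq Yq in Em1 Em2; nra.
  - by subst r s; case: om => t t01 [Em1 Em2]; rewrite Xq Yq in Em1 Em2; nra.
  - by apply: (nov w 1) => //; lra.
have hit1 r s (x y : R) : e r s -> 0 < x -> 0 < y -> x + y = 1 -> on_seg X Y r s x y ->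
    (exists m1 m2, on_seg X Y r s m1 m2 /\ m1 + m2 < 1) -> False.
  move=> ers x0 y0 xy ox [m1 [m2 [om mlt]]].
  case: (planar_cross pl epq ers (onpq _ _ x0 (ltW y0) xy) ox)
      => [[E1 E2]|[E1 E2]|[w [wpq _ E1 E2]]].
  - by subst r s; case: om => t t01 [Em1 Em2]; rewrite Xq Yq in Em1 Em2; nra.
  - by subst r s; case: om => t t01 [Em1 Em2]; rewrite Xq Yq in Em1 Em2; nra.
  - by case: wpq => ?; subst w; lra.
pose W w := [/\ w <> z, 0 <= X w, 0 <= Y w & X w + Y w <= 1].
have WY w : W w -> 0 < Y w.
  move=> [wz X0 Y0 XY]; rewrite lt_neqAle Y0 andbT; apply/eqP => Y00.
  have : 0 < X w.
    rewrite lt_neqAle X0 andbT; apply/eqP => X00.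
    by apply: wz; apply: (planar_inj pl); lra.
  by move=> X1; apply: (nov w (X w)) => //; lra.
(* Ties in the angle are broken by [Y], so that no vertex lies between [z] and [w]. *)
have [|w Ww wmin] := @ex_lexmin R V W (fun w => - (X w / Y w)) Y.
  by exists q; split; rewrite ?Xq ?Yq; [move=> E; subst q; lra|lra|lra|lra].
have Yw := WY _ Ww; have [wz Xw0 _ XYw] := Ww.
have ratio u : W u -> X u * Y w <= X w * Y u.
  move=> Wu; have Yu := WY _ Wu.
  have : X u / Y u <= X w / Y w by case: (wmin _ Wu) => [|[]]; lra.
  by rewrite ler_pdivrMr // mulrAC ler_pdivlMr.
have tie u : W u -> X u * Y w = X w * Y u -> Y w <= Y u.
  move=> Wu E; have Yu := WY _ Wu.
  have E2 : X u / Y u = X w / Y w.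
    by apply/eqP; rewrite eqr_div ?lt0r_neq0 // E.
  by case: (wmin _ Wu) => [|[]] //; rewrite E2 ltxx.
exists w; split=> //; last exact: ltW.
apply: contrapT => /negP nzw.
have [|t t01 bl] := sat z w _ nzw; first by move=> E; apply: wz.
rewrite Xz Yz !mulr0 !add0r in bl.
have nov_m u : t * X w = X u -> t * Y w = Y u -> False.
  move=> Xu Yu; have Wu : W u.
    by split; rewrite -?Xu -?Yu; [move=> E; subst u; nra|nra|nra|nra].
  have : Y w <= Y u by apply: tie => //; rewrite -Xu -Yu; ring.
  by nra.
case: bl => [[u [Xu Yu]]|[r [s [ers om]]]]; first exact: (nov_m u).
have my0 : 0 < t * Y w < Y w by clear -t01 Yw; nra.
have msum : t * X w + t * Y w < 1 by clear -t01 XYw Yw Xw0; nra.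
have mE : t * X w * Y w = t * Y w * X w by ring.
have low r' s' : e r' s' -> on_seg X Y r' s' (t * X w) (t * Y w) ->
    0 < X r' * Y w - Y r' * X w -> False.
  move=> ers' o Dr.
  have m1 : exists m1 m2, on_seg X Y r' s' m1 m2 /\ m1 + m2 < 1.
    by exists (t * X w), (t * Y w).
  apply: (exit_low_side o mE) => //; first by case/andP: my0.
  - move=> Yr XYr; have Wr : W r'.
      split=> //; [by move=> E; subst r'; clear -Yr Yz; lra| |exact: ltW].
      by clear -Dr Yr Yw Xw0; nra.
    by have := ratio _ Wr; clear -Dr; lra.
  - by move=> x x01 ox; apply: (hit0 r' s' x).
  - by move=> x y x0 y0 xy ox; apply: (hit1 r' s' x y).
have tie' u : X u * Y w = X w * Y u -> 0 < Y u < Y w -> False.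
  move=> E Yu; have Wu : W u.
    split; [by move=> Eu; subst u; clear -Yu Yz; lra| | |].
    - by clear -E Yu Yw Xw0; nra.
    - by clear -Yu; lra.
    - by clear -E Yu Yw Xw0 XYw; nra.
  by have := tie _ Wu E; clear -Yu; lra.
have [t2 t201 [E1 E2]] := om.
have Dm : (1 - t2) * (X r * Y w - Y r * X w) + t2 * (X s * Y w - Y s * X w) = 0.
  by transitivity ((t * X w) * Y w - (t * Y w) * X w); [rewrite E1 E2; ring | ring].
have t2_gt0 : 0 < t2.
  rewrite lt_neqAle (andP t201).1 andbT; apply/eqP => E; subst t2.
  by apply: (nov_m r); clear -E1 E2; lra.
have t2_lt1 : t2 < 1.
  rewrite lt_neqAle (andP t201).2 andbT; apply/eqP => E; subst t2.
  by apply: (nov_m s); clear -E1 E2; lra.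
have esr : e s r by rewrite esym.
have [D1|D1|D1] := ltgtP 0 (X r * Y w - Y r * X w).
- exact: (low r s).
- by apply: (low s r) => //; [exact: on_segC|clear -D1 Dm t2_gt0 t2_lt1; nra].
- have Ds : X s * Y w = X w * Y s by clear -D1 Dm t2_gt0; nra.
  have Dr : X r * Y w = X w * Y r by clear -D1; lra.
  have [Yr|Yr|Yr] := ltgtP (Y r) (t * Y w).
  + exact: (@collinear_obstacle R V e X Y z w r s _ _ pl Xz Yz nzw wz Yw tie' ers om).
  + apply: (@collinear_obstacle R V e X Y z w s r _ _ pl Xz Yz nzw wz Yw tie' esr (on_segC om)) => //.
    by clear -Yr E2 t2_gt0 t2_lt1; nra.
  + by apply: (nov_m r) => //; apply: (mulIf (lt0r_neq0 Yw)); rewrite Dr Yr; ring.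
Qed.

(** If the lowest vertex [y] above [z] is not a neighbour, let [c] be the first point of the segment
    [z y] on an edge [p q], with [q] the higher end. With [c] and [q] as basis, [visible_vertex]
    gives a neighbour in the cone they span, and this cone lies above [z]. *)
Lemma upward_neighbor (R : realFieldType) (V : finType) (e : rel V) (X Y : V -> R)
    (z : V) :
  symmetric e -> planar e X Y -> saturated e X Y -> X z = 0 -> Y z = 0 ->
  (exists y, 0 < Y y) -> exists2 w, e z w & 0 < Y w.
Proof.
move=> esym pl sat Xz Yz /(ex_argmin Y)[y Yy ymin].
case: (boolP (e z y)) => [ezy|nzy]; first by exists y.
have yz : y <> z by move=> E; rewrite E Yz ltxx in Yy.
have nov u : 0 < Y u < Y y -> False.
  by move=> /andP[/ymin]; rewrite leNgt => /negP.
(* The signed offset of [u] from the line [z y]; [transv] shows that the ends of an edge in the way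
   have different offsets. *)
pose D u := X u * Y y - Y u * X y.
pose hits (rs : V * V) t :=
  [/\ e rs.1 rs.2, 0 < t < 1 & on_seg X Y rs.1 rs.2 (t * X y) (t * Y y)].
have hitsC r s t : hits (r, s) t -> hits (s, r) t.
  by move=> [/= ers t01 o]; split=> //=; [rewrite esym|exact: on_segC].
have comb r s t : hits (r, s) t -> exists tau,
    [/\ 0 < tau < 1, (1 - tau) * D r + tau * D s = 0 &
     t * Y y = (1 - tau) * Y r + tau * Y s].
  move=> [/= ers t01 [tau tau01 [E1 E2]]]; exists tau; split=> //; last first.
    by rewrite /D; transitivity ((t * X y) * Y y - (t * Y y) * X y);
      [rewrite E1 E2; ring | ring].
  have nm : 0 < t * Y y < Y y by clear -t01 Yy; nra.
  case/andP: tau01 => tau0 tau1; rewrite !lt_neqAle tau0 tau1 !andbT.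
  apply/andP; split; apply/eqP => E; subst tau.
    by apply: (nov r); rewrite (_ : Y r = t * Y y) // E2; ring.
  by apply: (nov s); rewrite (_ : Y s = t * Y y) // E2; ring.
have transv0 r s t : hits (r, s) t -> D r = 0 -> D s = 0 -> Y r < t * Y y -> False.
  move=> [/= ers t01 o] Dr Ds Yr.
  apply: (@collinear_obstacle R V e X Y z y r s _ _ pl Xz Yz nzy yz Yy _ ers o) => //.
  - by move=> u _; exact: nov.
  - by clear -t01 Yy; nra.
  - by move: Dr; rewrite /D; clear; lra.
  - by move: Ds; rewrite /D; clear; lra.
have transv r s t : hits (r, s) t -> D r = D s -> False.
  move=> h Ers; have [tau [tau01 E1 E2]] := comb _ _ _ h.
  have Dr : D r = 0 by clear -E1 Ers; rewrite -Ers in E1; lra.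
  have Ds : D s = 0 by rewrite -Ers.
  have [Yr|Yr|Yr] := ltgtP (Y r) (t * Y y).
  - exact: (transv0 r s t).
  - by apply: (transv0 s r t) => //; [exact: hitsC|clear -Yr E2 tau01; nra].
  - by case: h => /= _ t01 _; apply: (nov r); rewrite Yr; clear -t01 Yy; nra.
(* The parameter at which the line of an edge meets the line [z y]. As a function on pairs of
   vertices it has a minimum, which gives the first obstacle. *)
pose T (rs : V * V) := (X rs.2 * Y rs.1 - Y rs.2 * X rs.1) / (D rs.2 - D rs.1).
have hitsT rs t : hits rs t -> t = T rs.
  case: rs => r s h; have Drs : D s - D r != 0.
    by rewrite subr_eq0; apply/eqP => E; exact: (transv r s t).
  case: h => /= _ _ [tau _ [E1 E2]].
  apply: (mulIf Drs); rewrite /T /= mulfVK //.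
  have -> : t * (D s - D r) = (X s - X r) * (t * Y y) - (Y s - Y r) * (t * X y).
    by rewrite /D; ring.
  by rewrite E1 E2; ring.
have [|[p q] [t0 h0] tmin] := @ex_argmin R (V * V)%type (fun rs => exists t, hits rs t) T.
  have [|t t01] := sat z y _ nzy; first by move=> E; apply: yz.
  rewrite Xz Yz !mulr0 !add0r => -[[u [Xu Yu]]|[r [s [ers o]]]].
    by case: (nov u); rewrite -Yu; clear -t01 Yy; nra.
  by exists (r, s), t.
wlog Ypq : p q h0 tmin / Y p <= Y q.
  move=> H; have [pq|pq] := lerP (Y p) (Y q); first exact: (H p q).
  apply: (H q p) => //; [exact: hitsC| |exact: ltW].
  move=> rs /tmin le; rewrite -(hitsT _ _ (hitsC _ _ _ h0)) (hitsT _ _ h0).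
  exact: le.
have t0E := hitsT _ _ h0.
have [epq t01 o] := h0; rewrite /= in epq o.
have [tau [tau01 E1 E2]] := comb _ _ _ h0.
have Yc : 0 < t0 * Y y < Y y by clear -t01 Yy; nra.
have Yq : 0 < Y q by clear -E2 Ypq tau01 Yc; nra.
have Dq : D q != 0.
  apply/eqP => Dq; apply: (transv _ _ _ h0).
  by rewrite Dq in E1 *; clear -E1 tau01; nra.
set cx := t0 * X y in o *; set cy := t0 * Y y in o Yc E2 *.
(* [De] is the determinant of the basis [c], [q]; the linear map below sends [c] to [(1, 0)] and [q]
   to [(0, 1)]. *)
have [De DeE] : exists De, De = cx * Y q - cy * X q by eexists.
have De0 : De != 0.
  have -> : De = - t0 * D q by rewrite DeE /D /cx /cy; ring.
  by rewrite mulf_neq0 // oppr_eq0 lt0r_neq0 //; case/andP: t01.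
have Dne : Y q / De * (cx / De) - - X q / De * (- cy / De) != 0.
  have -> : Y q / De * (cx / De) - - X q / De * (- cy / De) = De^-1.
    transitivity ((cx * Y q - cy * X q) / (De * De)); first by field.
    by rewrite -DeE invfM mulrA divff // mul1r.
  by rewrite invr_eq0.
have img (t : R) : Y q / De * (t * cx) + - X q / De * (t * cy) + 0 = t /\
    - cy / De * (t * cx) + cx / De * (t * cy) + 0 = 0.
  split; last by field.
  transitivity (t * (cx * Y q - cy * X q) / De); first by field.
  by rewrite -DeE mulfK.
have [||||||w tw w01 E|r s t ers t1 or|w [ezw wz Xw Yw]] :=
  @visible_vertex R V e (affine (Y q / De) (- X q / De) 0 X Y)
    (affine (- cy / De) (cx / De) 0 X Y) z p q esym (planar_affine 0 0 Dne pl)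
    (saturated_affine 0 0 Dne sat).
- by rewrite /affine Xz Yz; ring.
- by rewrite /affine Xz Yz; ring.
- by rewrite /affine; ring.
- transitivity ((cx * Y q - cy * X q) / De); first by rewrite /affine; field.
  by rewrite -DeE divff.
- by [].
- have [I1 I2] := img 1; rewrite !mul1r in I1 I2.
  by have := (on_seg_affine X Y 0 0 p q cx cy Dne).2 o; rewrite I1 I2.
- move=> E'; have [F1 F2] := img tw.
  have [_ EY] : X w = tw * cx /\ Y w = tw * cy.
    apply: (affine_inj Dne); first by apply: (addIr 0); rewrite F1.
    by apply: (addIr 0); rewrite F2.
  by apply: (nov w); rewrite EY; clear -w01 Yc; nra.
- have {}or : on_seg X Y r s (t * cx) (t * cy).
    by apply/(on_seg_affine X Y 0 0 r s _ _ Dne); have [-> ->] := img t.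
  have hrs : hits (r, s) (t * t0).
    by split=> //=; [clear -t1 t01; nra|rewrite -!mulrA].
  have := tmin (r, s) (ex_intro _ _ hrs).
  by rewrite -(hitsT _ _ hrs) -t0E; clear -t1 t01; nra.
exists w => //.
have EX : X w = affine (Y q / De) (- X q / De) 0 X Y w * cx +
    affine (- cy / De) (cx / De) 0 X Y w * X q.
  transitivity (X w * (cx * Y q - cy * X q) / De); first by rewrite -DeE mulfK.
  by rewrite /affine; field.
have EY : Y w = affine (Y q / De) (- X q / De) 0 X Y w * cy +
    affine (- cy / De) (cx / De) 0 X Y w * Y q.
  transitivity (Y w * (cx * Y q - cy * X q) / De); first by rewrite -DeE mulfK.
  by rewrite /affine; field.
have Y0 : 0 <= Y w by rewrite EY; clear -Xw Yw Yc Yq; nra.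
rewrite lt_neqAle Y0 andbT; apply/eqP => E0.
have [a0 b0] : affine (Y q / De) (- X q / De) 0 X Y w = 0 /\
     affine (- cy / De) (cx / De) 0 X Y w = 0.
  by rewrite EY in E0; clear -Xw Yw Yc Yq E0; split; nra.
apply: wz; apply: (planar_inj pl); last by rewrite -E0.
by rewrite EX a0 b0 Xz; ring.
Qed.

Lemma higher_neighbor (R : realFieldType) (V : finType) (e : rel V) (X Y : V -> R)
    (f g : R) (z : V) :
  symmetric e -> planar e X Y -> saturated e X Y ->
  (exists y, f * X z + g * Y z < f * X y + g * Y y) ->
  exists2 w, e z w & f * X z + g * Y z < f * X w + g * Y w.
Proof.
move=> esym pl sat [y hy].
have D : g * g - - f * f != 0.
  apply/eqP => E; have f0 : f = 0 by clear -E; nra.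
  by have g0 : g = 0 by [clear -E; nra]; rewrite f0 g0 in hy; clear -hy; lra.
have [|||w ezw hw] := upward_neighbor esym
  (planar_affine (- (g * X z + - f * Y z)) (- (f * X z + g * Y z)) D pl)
  (saturated_affine (- (g * X z + - f * Y z)) (- (f * X z + g * Y z)) D sat)
  (z := z); rewrite ?/affine ?subrr //.
- by exists y; rewrite /affine subr_gt0.
- by exists w => //; rewrite -subr_gt0.
Qed.

(** * Consecutive neighbours of a vertex are adjacent *)

Lemma on_seg_swap (R : realFieldType) (V : finType) (X Y : V -> R) (u v : V)
    (p q : R) : on_seg X Y u v p q -> on_seg Y X u v q p.
Proof. by move=> [t t01 [-> ->]]; exists t. Qed.

Lemma planar_swap (R : realFieldType) (V : finType) (e : rel V) (X Y : V -> R) :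
  planar e X Y -> planar e Y X.
Proof.
move=> pl; split.
- by move=> u v E1 E2; apply: (planar_inj pl).
- by move=> u v w euv /on_seg_swap; apply: (planar_vertex pl).
- move=> u v x y p q euv exy /on_seg_swap o1 /on_seg_swap o2.
  case: (planar_cross pl euv exy o1 o2) => [?|?|[w [? ? ? ?]]].
  + exact: Or31.
  + exact: Or32.
  + by apply: Or33; exists w.
Qed.

(** On the way to [r] the edge [r s] meets the axis [X = 0] at the parameter [m / (m - X r)]; the
    last hypothesis puts this point on the edge [v b]. *)
Lemma no_exit_side (R : realFieldType) (V : finType) (e : rel V) (X Y : V -> R)
    (v b r s : V) (m n : R) :
  planar e X Y -> X v = 0 -> Y v = 0 -> X b = 0 -> Y b = 1 -> e v b -> e r s ->
  on_seg X Y r s m n -> 0 < m -> X r < 0 ->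
  0 <= n + m / (m - X r) * (Y r - n) <= 1 -> False.
Proof.
move=> pl Xv Yv Xb Yb evb ers o m0 Xr; set l := m / (m - X r) => y01.
have d0 : 0 < m - X r by clear -m0 Xr; lra.
have lE : l * (m - X r) = m by rewrite /l mulfVK // lt0r_neq0.
have l01 : 0 <= l <= 1.
  by apply/andP; split; [apply: divr_ge0|rewrite ler_pdivrMr //]; clear -m0 Xr; lra.
have o1 := on_seg_sub o l01.
have x0 : m + l * (X r - m) = 0 by clear -lE; lra.
have o2 : on_seg X Y v b (m + l * (X r - m)) (n + l * (Y r - n)).
  by exists (n + l * (Y r - n)) => //; rewrite x0 Xv Yv Xb Yb; split; ring.
case: (planar_cross pl evb ers o2 o1) => [[E1 E2]|[E1 E2]|[w [w1 w2 E1 E2]]].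
- by subst r; rewrite Xv ltxx in Xr.
- by subst r; rewrite Xb ltxx in Xr.
- rewrite x0 in E1; case: w2 => E; subst w; first by rewrite -E1 ltxx in Xr.
  by case: o => t t01 [Em _]; rewrite -E1 in Em; clear -Em t01 m0 Xr; nra.
Qed.

(** Since [X + Y] does not grow on the way to [r], the quadrant could be left only through the unit
    segments [v a] and [v b], which are edges. The sign of [m * Y r - n * X r] tells which of them
    would be met. *)
Lemma no_exit_wedge (R : realFieldType) (V : finType) (e : rel V) (X Y : V -> R)
    (v a b r s : V) (m n : R) :
  planar e X Y -> X v = 0 -> Y v = 0 -> X a = 1 -> Y a = 0 -> X b = 0 -> Y b = 1 ->
  e v a -> e v b -> e r s -> on_seg X Y r s m n -> 0 < m -> 0 < n -> m + n <= 1 ->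
  X r + Y r <= m + n -> 0 <= X r /\ 0 <= Y r.
Proof.
move=> pl Xv Yv Xa Ya Xb Yb eva evb ers o m0 n0 mn1 rmn.
have sideX : X r < 0 -> 0 <= n + m / (m - X r) * (Y r - n) -> False.
  move=> Xr y0; apply: (no_exit_side pl Xv Yv Xb Yb evb ers o) => //.
  rewrite y0 /=.
  have d0 : 0 < m - X r by clear -m0 Xr; lra.
  have lE : m / (m - X r) * (m - X r) = m by rewrite mulfVK // lt0r_neq0.
  have l0 : 0 <= m / (m - X r) by apply: divr_ge0; clear -m0 Xr; lra.
  by clear y0; move: (m / (m - X r)) lE l0 => l lE l0; clear -lE l0 rmn mn1; nra.
have sideY : Y r < 0 -> 0 <= m + n / (n - Y r) * (X r - m) -> False.
  move=> Yr x0; apply: (no_exit_side (planar_swap pl) Yv Xv Ya Xa eva ers (on_seg_swap o)) => //.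
  rewrite x0 /=.
  have d0 : 0 < n - Y r by clear -n0 Yr; lra.
  have lE : n / (n - Y r) * (n - Y r) = n by rewrite mulfVK // lt0r_neq0.
  have l0 : 0 <= n / (n - Y r) by apply: divr_ge0; clear -n0 Yr; lra.
  by clear x0; move: (n / (n - Y r)) lE l0 => l lE l0; clear -lE l0 rmn mn1; nra.
have wX : X r < 0 -> n + m / (m - X r) * (Y r - n) = (m * Y r - n * X r) / (m - X r).
  by move=> Xr; field; apply: lt0r_neq0; clear -m0 Xr; lra.
have wY : Y r < 0 -> m + n / (n - Y r) * (X r - m) = (n * X r - m * Y r) / (n - Y r).
  by move=> Yr; field; apply: lt0r_neq0; clear -n0 Yr; lra.
have [c|c] := lerP (n * X r) (m * Y r).
  have Xr : 0 <= X r.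
    rewrite leNgt; apply/negP => Xr; apply: (sideX Xr); rewrite wX //.
    by apply: divr_ge0; clear -c Xr m0; lra.
  by split=> //; clear -Xr c m0 n0; nra.
have Yr : 0 <= Y r.
  rewrite leNgt; apply/negP => Yr; apply: (sideY Yr); rewrite wY //.
  by apply: divr_ge0; clear -c Yr n0; lra.
by split=> //; clear -Yr c m0 n0; nra.
Qed.

(* A vertex of the triangle [v a b] closest to [v] in the direction transversal to
   [a b] would be visible from [v], hence a neighbour inside the wedge. *)
Lemma unit_wedge_adjacent (R : realFieldType) (V : finType) (e : rel V)
    (X Y : V -> R) (v a b : V) :
  symmetric e -> planar e X Y -> saturated e X Y ->
  X v = 0 -> Y v = 0 -> X a = 1 -> Y a = 0 -> X b = 0 -> Y b = 1 ->
  e v a -> e v b -> (forall x, e v x -> 0 < X x -> 0 < Y x -> False) -> e a b.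
Proof.
move=> esym pl sat Xv Yv Xa Ya Xb Yb eva evb nov.
(* The lower end [r] of an obstacle stays in the quadrant. It is not [v], whose neighbours avoid the
   open wedge, and on an axis it lies on the edge [v a] or [v b], so it is [a] or [b]. *)
have obst r s m n : e r s -> on_seg X Y r s m n -> 0 < m -> 0 < n -> m + n <= 1 ->
    X r + Y r <= m + n -> [\/ r = a, r = b | 0 < X r /\ 0 < Y r].
  move=> ers o m0 n0 mn rmn.
  have [X0 Y0] := no_exit_wedge pl Xv Yv Xa Ya Xb Yb eva evb ers o m0 n0 mn rmn.
  have rv : r <> v.
    move=> E; subst r; case: o => t t01 [Em En]; rewrite Xv Yv in Em En.
    by apply: (nov s ers); [clear -Em t01 m0 | clear -En t01 n0]; nra.
  have [X1|X1] := ltrP 0 (X r); last first.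
    have Xr : X r = 0 by clear -X0 X1; lra.
    have [|//|E] := @planar_vertex _ _ _ _ _ pl v b r evb; last exact: Or32.
    exists (Y r); first by clear -Y0 rmn mn Xr; lra.
    by rewrite Xv Yv Xb Yb Xr; split; ring.
  have [Y1|Y1] := ltrP 0 (Y r); last first.
    have Yr : Y r = 0 by clear -Y0 Y1; lra.
    have [|//|E] := @planar_vertex _ _ _ _ _ pl v a r eva; last exact: Or31.
    exists (X r); first by clear -X0 rmn mn Yr; lra.
    by rewrite Xv Yv Xa Ya Yr; split; ring.
  exact: Or33.
have low r s m n : on_seg X Y r s m n -> X r + Y r <= m + n \/ X s + Y s <= m + n.
  move=> [t t01 [-> ->]].
  by have [h|h] := lerP (X r + Y r) (X s + Y s); [left|right]; clear -t01 h; nra.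
have notri w : 0 < X w -> 0 < Y w -> X w + Y w <= 1 -> False.
  move=> X0 Y0 XY.
  have [|{X0 Y0 XY}w [X0 Y0 XY] wmin] := @ex_argmin R V
    (fun w => [/\ 0 < X w, 0 < Y w & X w + Y w <= 1]) (fun w => X w + Y w).
    by exists w.
  apply: (nov w) => //; apply: contrapT => /negP nvw.
  have vw : v <> w by move=> E; rewrite -E Xv ltxx in X0.
  have [t t01] := sat v w vw nvw; rewrite Xv Yv !mulr0 !add0r.
  have m0 : 0 < t * X w by clear -t01 X0; nra.
  have n0 : 0 < t * Y w by clear -t01 Y0; nra.
  have mnw : t * X w + t * Y w < X w + Y w by clear -t01 X0 Y0; nra.
  have mn1 : t * X w + t * Y w <= 1 by clear -mnw XY; lra.
  have smaller u : 0 < X u -> 0 < Y u -> X u + Y u <= t * X w + t * Y w -> False.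
    move=> Xu Yu uw; have /wmin : [/\ 0 < X u, 0 < Y u & X u + Y u <= 1].
      by split=> //; clear -uw mn1; lra.
    by clear -uw mnw; lra.
  move=> [[u [Xu Yu]]|[r [s [ers o]]]].
    by apply: (smaller u); rewrite -?Xu -?Yu.
  have fin r' s' : e r' s' -> on_seg X Y r' s' (t * X w) (t * Y w) ->
      X r' + Y r' <= t * X w + t * Y w -> False.
    move=> ers' o' le.
    case: (obst _ _ _ _ ers' o' m0 n0 mn1 le) => [E|E|[Xr Yr]]; last exact: (smaller r').
      by subst r'; rewrite Xa Ya in le; clear -le mnw XY; lra.
    by subst r'; rewrite Xb Yb in le; clear -le mnw XY; lra.
  case: (low _ _ _ _ o) => le; first exact: (fin r s).
  by apply: (fin s r) => //; [rewrite esym|exact: on_segC].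
(* As the triangle contains no further vertex, an obstacle on [a b] starts at [a] or [b] and runs
   along the line [a b]; it must end at the other of the two. *)
apply: contrapT => /negP nab.
have ab : a <> b by move=> E; rewrite E Xb in Xa; clear -Xa; lra.
have [t t01] := sat a b ab nab; rewrite Xa Ya Xb Yb !mulr0 !mulr1 addr0 add0r.
have m0 : 0 < 1 - t by clear -t01; lra.
have n0 : 0 < t by clear -t01; lra.
have mn1 : 1 - t + t <= 1 by clear; lra.
move=> [[u [Xu Yu]]|[r [s [ers o]]]].
  by apply: (notri u); rewrite -?Xu -?Yu.
have fin r' s' : e r' s' -> on_seg X Y r' s' (1 - t) t -> X r' + Y r' <= 1 - t + t -> False.
  move=> ers' o' le.
  case: (obst _ _ _ _ ers' o' m0 n0 mn1 le) => [E|E|[Xr Yr]]; last first.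
  - by apply: (notri r') => //; clear -le; lra.
  - subst r'; case: o' => l l01 [El1 El2]; rewrite Xb Yb mulr0 add0r in El1 El2.
    have Xs : 0 < X s' by clear -El1 l01 m0; nra.
    have Es : X s' + Y s' = 1 by clear -El1 El2 l01 m0 Xs; nra.
    have [S1|S1|S1] := ltgtP (X s') 1.
    + by apply: (notri s') => //; [clear -S1 Es|clear -Es]; lra.
    + have [|E|E] := @planar_vertex _ _ _ _ _ pl b s' a ers'.
      * exists ((X s')^-1); first by rewrite invr_ge0 invf_le1 // !ltW.
        rewrite Xb Yb Xa Ya (_ : Y s' = 1 - X s'); last by clear -Es; lra.
        by split; field; apply: lt0r_neq0.
      * by rewrite E in ab.
      * by subst s'; rewrite Xa ltxx in S1.
    + have E : s' = a by apply: (planar_inj pl); rewrite ?Xa ?Ya //; clear -S1 Es; lra.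
      by subst s'; rewrite esym ers' in nab.
  - subst r'; case: o' => l l01 [El1 El2]; rewrite Xa Ya mulr0 add0r in El1 El2.
    have Ys : 0 < Y s' by clear -El2 l01 n0; nra.
    have Es : X s' + Y s' = 1 by clear -El1 El2 l01 n0 Ys; nra.
    have [S1|S1|S1] := ltgtP (Y s') 1.
    + by apply: (notri s') => //; [clear -S1 Es|clear -Es]; lra.
    + have [|E|E] := @planar_vertex _ _ _ _ _ pl a s' b ers'.
      * exists ((Y s')^-1); first by rewrite invr_ge0 invf_le1 // !ltW.
        rewrite Xb Yb Xa Ya (_ : X s' = 1 - Y s'); last by clear -Es; lra.
        by split; field; apply: lt0r_neq0.
      * by rewrite E in ab.
      * by subst s'; rewrite Yb ltxx in S1.
    + have E : s' = b by apply: (planar_inj pl); rewrite ?Xb ?Yb //; clear -S1 Es; lra.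
      by subst s'; rewrite ers' in nab.
case: (low _ _ _ _ o) => le; first exact: (fin r s).
by apply: (fin s r) => //; [rewrite esym|exact: on_segC].
Qed.

(** Twice the signed area of the triangle formed by [u], [v] and the point: positive to the left of
    the line from [u] to [v]. *)
Definition side (R : realFieldType) (V : finType) (X Y : V -> R) (u v : V)
    (p q : R) : R := (X v - X u) * (q - Y u) - (Y v - Y u) * (p - X u).

Definition area (R : realFieldType) (V : finType) (X Y : V -> R) (u v w : V) : R :=
  side X Y u v (X w) (Y w).

Lemma area_affine (R : realFieldType) (V : finType) (X Y : V -> R)
    (a b c d k l : R) (u v w : V) :
  area (affine a b k X Y) (affine c d l X Y) u v w = (a * d - b * c) * area X Y u v w.
Proof. by rewrite /area /side /affine; ring. Qed.

(** Barycentric coordinates with respect to [v a b] carry the wedge to the unit one. *)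
Lemma wedge_adjacent (R : realFieldType) (V : finType) (e : rel V)
    (X Y : V -> R) (v a b : V) :
  symmetric e -> planar e X Y -> saturated e X Y ->
  e v a -> e v b -> 0 < area X Y v a b ->
  (forall x, e v x -> 0 < area X Y v a x -> 0 < area X Y v x b -> False) -> e a b.
Proof.
move=> esym pl sat eva evb; move DE : (area X Y v a b) => D D0 nov.
have Dn : D != 0 by exact: lt0r_neq0.
pose k := ((X b - X v) * Y v - (Y b - Y v) * X v) / D.
pose l := ((Y a - Y v) * X v - (X a - X v) * Y v) / D.
have X'E x : affine ((Y b - Y v) / D) (- (X b - X v) / D) k X Y x = area X Y v x b / D.
  by rewrite /affine /area /side /k; ring.
have Y'E x : affine (- (Y a - Y v) / D) ((X a - X v) / D) l X Y x = area X Y v a x / D.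
  by rewrite /affine /area /side /l; ring.
have D' : (Y b - Y v) / D * ((X a - X v) / D) -
    - (X b - X v) / D * (- (Y a - Y v) / D) != 0.
  rewrite (_ : _ - _ = area X Y v a b / (D * D)).
    by rewrite DE invfM mulrA divff // mul1r invr_eq0.
  by rewrite /area /side; field.
have Avv x : area X Y v x x = 0 by rewrite /area /side; ring.
have Avx x : area X Y v v x = 0 by rewrite /area /side; ring.
have Axv x : area X Y v x v = 0 by rewrite /area /side; ring.
apply: (unit_wedge_adjacent esym (planar_affine k l D' pl) (saturated_affine k l D' sat)
  (v := v)) => //; rewrite ?X'E ?Y'E ?Avv ?Avx ?Axv ?mul0r ?DE ?divff //.
by move=> x evx; rewrite X'E Y'E !pmulr_lgt0 ?invr_gt0 // => h1 h2; exact: (nov x).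
Qed.

(** * Extreme vertices and the outer triangle of the given drawing *)

Lemma small_perturbation (R : realFieldType) (T : finType) (P : T -> Prop)
    (A B : T -> R) :
  (forall x, P x -> 0 < A x \/ (A x = 0 /\ 0 < B x)) ->
  exists2 eps : R, 0 < eps & forall x, P x -> 0 < A x + eps * B x.
Proof.
move=> AB; case: (pselect (exists x, P x /\ 0 < A x)) => [ex|nex]; last first.
  exists 1 => // x Px; case: (AB x Px) => [Ax|[-> Bx]]; last by lra.
  by case: nex; exists x.
have [x0 [Px0 Ax0] xmin] := ex_argmin (fun x => A x / (1 + `|B x|)) ex.
have B1 x : 0 < 1 + `|B x| by rewrite ltr_pwDl.
have eps0 : 0 < A x0 / (1 + `|B x0|) by exact: divr_gt0.
(* With this [eps], [eps * (1 + |B x|) <= A x] wherever [A x > 0], so the perturbation stays smaller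
   than [A x]. *)
exists (A x0 / (1 + `|B x0|)) => // x Px.
case: (AB x Px) => [Ax|[-> Bx]]; last by rewrite add0r mulr_gt0.
have := xmin x (conj Px Ax); rewrite ler_pdivlMr //.
move: (_ / _) eps0 => eps eps0; have := ler_norm (- B x); rewrite normrN.
by move: `|B x| => b; clear -eps0; nra.
Qed.

(** Tilting the first direction slightly towards the second turns a lexicographic maximum into a
    strict one. *)
Lemma lex_strictly_extreme (R : realFieldType) (V : finType) (X Y : V -> R)
    (f g f' g' : R) (v : V) :
  (forall x, x <> v -> f * X x + g * Y x < f * X v + g * Y v \/
    (f * X x + g * Y x = f * X v + g * Y v /\ f' * X x + g' * Y x < f' * X v + g' * Y v)) ->
  strictly_extreme X Y v.
Proof.
move=> lex; have [|eps eps0 H] := @small_perturbation R V (fun x => x <> v)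
    (fun x => f * X v + g * Y v - (f * X x + g * Y x))
    (fun x => f' * X v + g' * Y v - (f' * X x + g' * Y x)).
  by move=> x /lex [h|[h1 h2]]; [left|right]; [lra|split; lra].
by exists (f + eps * f'), (g + eps * g') => x /H; lra.
Qed.

Lemma ex_strictly_extreme (R : realFieldType) (V : finType) (e : rel V)
    (X Y : V -> R) : planar e X Y -> (0 < #|V|)%N -> exists v, strictly_extreme X Y v.
Proof.
move=> pl /card_gt0P[v0 _].
have [|v _ vmin] := @ex_lexmin R V (fun=> True) X Y; first by exists v0.
exists v; apply: (@lex_strictly_extreme _ _ _ _ (-1) 0 0 (-1)) => x xv.
case: (vmin x I) => [h|[h1 h2]]; first by left; lra.
right; split; first by lra.
have : Y v != Y x by apply/eqP => h3; apply: xv; apply: (planar_inj pl).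
by lra.
Qed.

Definition hull_triangle (R : realFieldType) (V : finType) (e : rel V)
    (X Y : V -> R) (a b c : V) : Prop :=
  [/\ e a b, e b c, e c a, 0 < area X Y a b c &
      forall x, [/\ 0 <= area X Y a b x, 0 <= area X Y b c x & 0 <= area X Y c a x]].

Lemma hull_triangle_affine (R : realFieldType) (V : finType) (e : rel V)
    (X Y : V -> R) (a b c d k l : R) (u v w : V) :
  0 < a * d - b * c ->
  hull_triangle e (affine a b k X Y) (affine c d l X Y) u v w -> hull_triangle e X Y u v w.
Proof.
move=> D0 [e1 e2 e3]; rewrite area_affine pmulr_rgt0 // => A0 tri; split=> // x.
by have := tri x; rewrite !area_affine !pmulr_rge0.
Qed.

(* After a rotation, a strictly extreme vertex is the origin and every other
   vertex lies to its right, so that slopes order the directions at it. *)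
Lemma rotate_extreme (R : realFieldType) (V : finType) (e : rel V) (X Y : V -> R) :
  planar e X Y -> (1 < #|V|)%N ->
  exists v a b c d k l, [/\ 0 < a * d - b * c, affine a b k X Y v = 0,
    affine c d l X Y v = 0, strictly_extreme X Y v &
    forall x, x <> v -> 0 < affine a b k X Y x].
Proof.
move=> pl V1; have [v [f [g se]]] := ex_strictly_extreme pl (ltnW V1).
exists v, (- f), (- g), g, (- f), (f * X v + g * Y v), (f * Y v - g * X v).
split; rewrite ?/affine; [|ring|ring|by exists f, g|by move=> x /se; lra].
have [x xv] : exists x, x <> v.
  by case/card_gt1P: V1 => x [y [_ _ xy]]; case: (pselect (x = v)) => [E|];
    [exists y => Ey; rewrite E Ey eqxx in xy | exists x].
have := se x xv; clear -R.
move: (X x) (Y x) (X v) (Y v) => p q p' q' h.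
have [f0|f0] := eqVneq f 0; last by have : 0 < f * f by [rewrite -expr2 exprn_even_gt0]; nra.
have [g0|g0] := eqVneq g 0; last by have : 0 < g * g by [rewrite -expr2 exprn_even_gt0]; nra.
by rewrite f0 g0 in h; lra.
Qed.

(** The exit time is the least [A i / (A i - B i)] over the coordinates that end negative. *)
Lemma first_exit (R : realFieldType) (T : finType) (A B : T -> R) :
  (forall i, 0 <= A i) -> (exists i, B i < 0) ->
  exists2 t : R, 0 <= t <= 1 & (forall i, 0 <= (1 - t) * A i + t * B i) /\
    exists i, (1 - t) * A i + t * B i = 0.
Proof.
move=> A0 /(ex_argmin (fun i => A i / (A i - B i))) [i Bi imin].
have d0 : 0 < A i - B i by have := A0 i; lra.
have tE : A i / (A i - B i) * (A i - B i) = A i by rewrite mulfVK // lt0r_neq0.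
exists (A i / (A i - B i)).
  by apply/andP; split; [apply: divr_ge0|rewrite ler_pdivrMr //]; have := A0 i; lra.
split; last by exists i; move: (_ / _) tE => t; clear; lra.
move=> j; have [Bj|Bj] := ltrP (B j) 0; last first.
  have : 0 <= A i / (A i - B i) <= 1.
    by apply/andP; split; [apply: divr_ge0|rewrite ler_pdivrMr //]; have := A0 i; lra.
  by move: (_ / _) (A0 j) => t Aj; clear -Bj Aj; nra.
have := imin j Bj; rewrite ler_pdivlMr; last by have := A0 j; lra.
by move: (_ / _) => t; clear; lra.
Qed.

Lemma on_side (R : realFieldType) (V : finType) (X Y : V -> R) (a b c : V) (p q : R) :
  0 < area X Y a b c -> side X Y a b p q = 0 -> 0 <= side X Y b c p q ->
  0 <= side X Y c a p q -> on_seg X Y a b p q.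
Proof.
move=> D0 s0 s1 s2.
have E : area X Y a b c = side X Y b c p q + side X Y c a p q.
  by rewrite -[RHS]add0r -s0 /area /side; ring.
(* The parameter is the barycentric coordinate belonging to [b]. *)
exists (side X Y c a p q / area X Y a b c).
  by apply/andP; split; [apply: divr_ge0|rewrite ler_pdivrMr //]; lra.
have Dn : area X Y a b c != 0 by exact: lt0r_neq0.
split; apply: (mulIf Dn).
  have -> : ((1 - side X Y c a p q / area X Y a b c) * X a +
    side X Y c a p q / area X Y a b c * X b) * area X Y a b c =
    area X Y a b c * X a + side X Y c a p q * (X b - X a) by field.
  transitivity (p * area X Y a b c + (X a - X c) * side X Y a b p q).
    by rewrite s0; ring.
  by rewrite /area /side; ring.
have -> : ((1 - side X Y c a p q / area X Y a b c) * Y a +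
  side X Y c a p q / area X Y a b c * Y b) * area X Y a b c =
  area X Y a b c * Y a + side X Y c a p q * (Y b - Y a) by field.
transitivity (q * area X Y a b c + (Y a - Y c) * side X Y a b p q).
  by rewrite s0; ring.
by rewrite /area /side; ring.
Qed.

Lemma area_rot (R : realFieldType) (V : finType) (X Y : V -> R) (a b c : V) :
  area X Y b c a = area X Y a b c.
Proof. by rewrite /area /side; ring. Qed.

Lemma exit_triangle (R : realFieldType) (V : finType) (X Y : V -> R) (a b c u w : V) :
  0 < area X Y a b c ->
  [/\ 0 <= area X Y a b u, 0 <= area X Y b c u & 0 <= area X Y c a u] ->
  ~ [/\ 0 <= area X Y a b w, 0 <= area X Y b c w & 0 <= area X Y c a w] ->
  exists p q, on_seg X Y u w p q /\
    [\/ on_seg X Y a b p q, on_seg X Y b c p q | on_seg X Y c a p q].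
Proof.
move=> D0 [u1 u2 u3] nw.
pose S (x : V) (i : option bool) := match i with
  | None => area X Y a b x | Some true => area X Y b c x | Some false => area X Y c a x end.
have [||t t01 [ge0 [i i0]]] := @first_exit R _ (S u) (S w).
- by case=> [[]|].
- apply: contrapT => h; apply: nw; split; rewrite leNgt; apply/negP => lt; apply: h.
  + by exists None.
  + by exists (Some true).
  + by exists (Some false).
have lin v v' : side X Y v v' ((1 - t) * X u + t * X w) ((1 - t) * Y u + t * Y w) =
    (1 - t) * area X Y v v' u + t * area X Y v v' w.
  by rewrite /area /side; ring.
exists ((1 - t) * X u + t * X w), ((1 - t) * Y u + t * Y w); split; first by exists t.
have h1 := ge0 None; have h2 := ge0 (Some true); have h3 := ge0 (Some false).
rewrite /= -!lin in h1 h2 h3.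
case: i i0 => [[]|] /= ; rewrite -lin => i0.
- by apply: Or32; apply: (on_side (c := a)) => //; rewrite area_rot.
- by apply: Or33; apply: (on_side (c := b)) => //; rewrite -area_rot.
- by apply: Or31; apply: (on_side (c := c)).
Qed.

Lemma ex_third (V : finType) (a b : V) : (2 < #|V|)%N -> exists x, x <> a /\ x <> b.
Proof.
move=> V2; apply: contrapT => h; move: V2; rewrite ltnNge => /negP; apply.
rewrite -cardsT; apply: (@leq_trans #|[set a; b]%SET|); last by rewrite cards2; case: (a != b).
apply: subset_leq_card; apply/fintype.subsetP => x _; rewrite !inE; apply: contrapT => nx.
by apply: h; exists x; split=> E; apply: nx; rewrite E eqxx ?orbT.
Qed.

Lemma sum_squares0 (R : realFieldType) (x y : R) : x * x + y * y = 0 -> x = 0 /\ y = 0.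
Proof.
move=> /eqP; rewrite -!expr2 paddr_eq0 ?sqr_ge0 // !sqrf_eq0.
by case/andP => /eqP -> /eqP ->.
Qed.

(** The vertex of least slope seen from [a], the farthest one in case of a tie, is a lexicographic
    maximum and hence strictly extreme. *)
Lemma slope_extreme (R : realFieldType) (V : finType) (e : rel V) (X Y : V -> R) (a : V) :
  planar e X Y -> X a = 0 -> Y a = 0 -> (forall x, x <> a -> 0 < X x) -> (1 < #|V|)%N ->
  exists b, [/\ b <> a, strictly_extreme X Y b, forall x, Y b * X x <= Y x * X b &
    forall x, Y b * X x = Y x * X b -> X x <= X b].
Proof.
move=> pl Xa Ya Xpos V1.
have [|b ba bmin] := @ex_lexmin R V (fun x => x <> a) (fun x => Y x / X x) (fun x => - X x).
  case/card_gt1P: V1 => x [y [_ _ xy]].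
  by case: (pselect (x = a)) => [E|]; [exists y => Ey; rewrite E Ey eqxx in xy|exists x].
have Xb := Xpos b ba.
have le x : Y b * X x <= Y x * X b.
  have [->|/eqP xa] := eqVneq x a; first by rewrite Xa Ya; lra.
  have Xx := Xpos x xa.
  have : Y b / X b <= Y x / X x by case: (bmin x xa) => [/ltW|[-> _]].
  by rewrite ler_pdivrMr // mulrAC ler_pdivlMr.
have tie x : Y b * X x = Y x * X b -> X x <= X b.
  have [->|/eqP xa E] := eqVneq x a; first by rewrite Xa ltW.
  have Xx := Xpos x xa.
  have E2 : Y b / X b = Y x / X x by apply/eqP; rewrite eqr_div ?lt0r_neq0 // E.
  by case: (bmin x xa) => [|[_]]; rewrite ?E2 ?ltxx //; lra.
exists b; split=> //.
apply: (@lex_strictly_extreme _ _ _ _ (Y b) (- X b) 1 0) => x xb.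
have [E|/eqP NE] := eqVneq (Y b * X x) (Y x * X b); last first.
  by left; have := le x; rewrite le_eqVlt => /orP[/eqP //|]; lra.
right; split; first by lra.
have : X x != X b.
  apply/eqP => E2; apply: xb; apply: (planar_inj pl) => //.
  by apply: (mulIf (lt0r_neq0 Xb)); rewrite -E E2.
by have := tie _ E; lra.
Qed.

Lemma strictly_extremeN (R : realFieldType) (V : finType) (X Y : V -> R) (a : V) :
  strictly_extreme X (fun x => - Y x) a -> strictly_extreme X Y a.
Proof. by move=> [f [g H]]; exists f, (- g) => x /H; lra. Qed.

Lemma planarN (R : realFieldType) (V : finType) (e : rel V) (X Y : V -> R) :
  planar e X Y -> planar e X (fun x => - Y x).
Proof.
move=> /(@planar_affine _ _ _ _ _ 1 0 0 (-1) 0 0 _) h.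
have -> : X = affine 1 0 0 X Y by apply/funext => x; rewrite /affine; ring.
have -> : (fun x => - Y x) = affine 0 (-1) 0 (affine 1 0 0 X Y) Y.
  by apply/funext => x; rewrite /affine; ring.
have -> : affine 0 (-1) 0 (affine 1 0 0 X Y) Y = affine 0 (-1) 0 X Y.
  by apply/funext => x; rewrite /affine; ring.
by apply: h; rewrite mulr0 subr0 mul1r oppr_eq0 oner_eq0.
Qed.

(** The vertices [b] and [c] of least and greatest slope are extreme, so [a], [b], [c] are pairwise
    adjacent. If some vertex lies beyond [b c], then an extreme one does, and its edge to [a] would
    cross [b c]. *)
Lemma hull_triangle_origin (R : realFieldType) (V : finType) (e : rel V)
    (X Y : V -> R) (a : V) :
  symmetric e -> planar e X Y -> extreme_adjacent e X Y ->
  X a = 0 -> Y a = 0 -> (forall x, x <> a -> 0 < X x) -> (2 < #|V|)%N ->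
  exists b c, hull_triangle e X Y a b c.
Proof.
move=> esym pl ext Xa Ya Xpos V2; have V1 := ltnW V2.
have sea : strictly_extreme X Y a.
  by exists (-1), 0 => x /Xpos; rewrite Xa Ya; lra.
have [b [ba seb leb tieb]] := slope_extreme pl Xa Ya Xpos V1.
have Ya' : - Y a = 0 by rewrite Ya oppr0.
have [c [ca /strictly_extremeN sec lec tiec]] := slope_extreme (planarN pl) Xa Ya' Xpos V1.
have Xb := Xpos b ba; have Xc := Xpos c ca.
have eab : e a b by apply: ext => // E; apply: ba.
have eca : e c a by apply: ext.
have Aab x : area X Y a b x = X b * Y x - Y b * X x.
  by rewrite /area /side Xa Ya !subr0.
have Aca x : area X Y c a x = Y c * X x - X c * Y x.
  by rewrite /area /side Xa Ya; ring.
have Ddef : area X Y a b c = X b * Y c - Y b * X c by rewrite Aab.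
(* In the degenerate case the tie-breaks give [b = c], all vertices are collinear, and a third one
   lies on the edge [a b]. *)
have D0 : 0 < area X Y a b c.
  rewrite lt_neqAle; apply/andP; split; last by rewrite Aab; have := leb c; lra.
  apply/eqP => D0; rewrite Ddef in D0.
  have bc : b = c.
    have Xbc : X b = X c.
      apply/le_anti/andP; split; [apply: tiec|apply: tieb]; lra.
    apply: (planar_inj pl) => //; apply: (mulIf (lt0r_neq0 Xb)).
    by rewrite {1}Xbc; lra.
  subst c; have [x [xa xb]] := ex_third a b V2.
  have Ex : Y b * X x = Y x * X b by have := leb x; have := lec x; lra.
  have [|//|//] := planar_vertex pl (w := x) eab.
  have Xx := Xpos x xa; exists (X x / X b).
    have := tieb x Ex => le.
    by apply/andP; split; [apply: divr_ge0|rewrite ler_pdivrMr //]; lra.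
  rewrite Xa Ya !mulr0 !add0r; split; first by rewrite mulfVK // lt0r_neq0.
  by rewrite mulrAC [X x * _]mulrC Ex mulfK // lt0r_neq0.
have bc : b <> c by move=> E; rewrite Ddef E in D0; lra.
have ebc : e b c by apply: ext.
exists b, c; split=> // x; split.
- by rewrite Aab; have := leb x; lra.
- apply: contrapT => /negP; rewrite -ltNge; move: x => x0 neg0.
  have [|x _ xmin] := @ex_lexmin R V (fun=> True) (fun x => area X Y b c x)
      (fun x => - ((X c - X b) * X x + (Y c - Y b) * Y x)); first by exists a.
  have neg : area X Y b c x < 0 by case: (xmin x0 I) => [|[-> //]] /lt_trans; apply.
  have sex : strictly_extreme X Y x.
    apply: (@lex_strictly_extreme _ _ _ _ (Y c - Y b) (- (X c - X b)) (X c - X b) (Y c - Y b)) => y yx.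
    have := xmin y I; rewrite /area /side => -[h|[h1 h2]]; first by left; lra.
    right; split; first by lra.
    rewrite lt_neqAle; apply/andP; split; last by lra.
    apply/eqP => h3; apply: yx.
    have n0 : (Y c - Y b) * (Y c - Y b) - - (X c - X b) * (X c - X b) != 0.
      rewrite mulNr opprK; apply/eqP => /sum_squares0 [E1 E2].
      by apply: bc; apply: (planar_inj pl); lra.
    by have [] := @affine_inj R (Y c - Y b) (- (X c - X b)) (X c - X b) (Y c - Y b)
      (X y) (Y y) (X x) (Y x) n0; [lra|lra|exact: (planar_inj pl)].
  have xa : x <> a by move=> E; subst x; rewrite area_rot in neg; lra.
  have xb : x <> b.
    by move=> E; subst x; move: neg; rewrite /area /side; lra.
  have xc : x <> c.
    by move=> E; subst x; move: neg; rewrite /area /side; lra.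
  have eax : e a x by apply: ext => // E; apply: xa.
  have Dbc : area X Y b c x = area X Y a b c - area X Y a b x - area X Y c a x.
    by rewrite /area /side; ring.
  pose d := area X Y a b x + area X Y c a x.
  have d0 : area X Y a b c < d by rewrite /d; lra.
  have d1 : 0 < d by lra.
  have p1 : 0 <= area X Y a b x by rewrite Aab; have := leb x; lra.
  have p2 : 0 <= area X Y c a x by rewrite Aca; have := lec x; lra.
  pose t := area X Y a b c / d.
  have o1 : on_seg X Y a x (t * X x) (t * Y x).
    exists t; last by rewrite Xa Ya !mulr0 !add0r.
    by apply/andP; split; [apply: divr_ge0|rewrite ler_pdivrMr //]; lra.
  have o2 : on_seg X Y b c (t * X x) (t * Y x).
    exists (area X Y a b x / d).
      by apply/andP; split; [apply: divr_ge0|rewrite ler_pdivrMr //]; rewrite /d; lra.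
    have dn := lt0r_neq0 d1.
    have -> : 1 - area X Y a b x / d = area X Y c a x / d.
      by apply: (mulIf dn); rewrite mulrBl !mulfVK // mul1r /d; ring.
    have scale (A B C x' y z : R) : A * x' = B * y + C * z ->
        A / d * x' = B / d * y + C / d * z.
      by move=> E; rewrite (mulrAC A) (mulrAC B) (mulrAC C) -mulrDl E.
    by rewrite /t; split; apply: scale; rewrite Ddef Aab Aca; ring.
  case: (planar_cross pl eax ebc o1 o2) => [[E1 E2]|[E1 E2]|[w [w1 w2 _ _]]].
  + by apply: ba.
  + by apply: ca.
  + by case: w1 w2 => -> [] //; [move=> E; apply: ba|move=> E; apply: ca].
- by rewrite Aca; have := lec x; lra.
Qed.

Lemma maximal_hull_triangle (R : realFieldType) (V : finType) (e : rel V) (X Y : V -> R) :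
  symmetric e -> planar e X Y -> extreme_adjacent e X Y -> (2 < #|V|)%N ->
  exists a b c, hull_triangle e X Y a b c.
Proof.
move=> esym pl ext V2.
have [v [a [b [c [d [k [l [D0 Xv Yv _ Xpos]]]]]]]] := rotate_extreme pl (ltnW V2).
have [u [w H]] := hull_triangle_origin esym (planar_affine k l (lt0r_neq0 D0) pl)
   (extreme_adjacent_affine ext) Xv Yv Xpos V2.
by exists v, u, w; apply: hull_triangle_affine H.
Qed.

(** * Connectivity of links and of blocks without two vertices *)

Lemma areaN (R : realFieldType) (V : finType) (X Y : V -> R) (v x y : V) :
  area X Y v y x = - area X Y v x y.
Proof. by rewrite /area /side; ring. Qed.

Lemma areaZ (R : realFieldType) (V : finType) (X Y : V -> R) (v x p q : V) (k : R) :
  X q - X v = k * (X p - X v) -> Y q - Y v = k * (Y p - Y v) ->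
  area X Y v x q = k * area X Y v x p.
Proof. by move=> E1 E2; rewrite /area /side E1 E2; ring. Qed.

Lemma collinear_scale (R : realFieldType) (x y x' y' : R) :
  x * y' - y * x' = 0 -> x <> 0 \/ y <> 0 -> exists k, x' = k * x /\ y' = k * y.
Proof.
move=> E nz; have n0 : x * x + y * y != 0.
  by apply/eqP => /sum_squares0 [x0 y0]; case: nz.
exists ((x * x' + y * y') / (x * x + y * y)); split; apply: (mulIf n0).
  rewrite -mulrAC mulfVK //; transitivity (x * (x * x' + y * y') - y * (x * y' - y * x')).
    by ring.
  by rewrite E; ring.
rewrite -mulrAC mulfVK //; transitivity (y * (x * x' + y * y') + x * (x * y' - y * x')).
  by ring.
by rewrite E; ring.
Qed.

(** If [p] and [q] were on the same side of [v], the nearer one would lie on the edge from [v] to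
    the other. *)
Lemma collinear_neighbors (R : realFieldType) (V : finType) (e : rel V)
    (X Y : V -> R) (v p q : V) :
  irreflexive e -> planar e X Y -> e v p -> e v q -> p <> q -> area X Y v p q = 0 ->
  exists2 k : R, k < 0 & X q - X v = k * (X p - X v) /\ Y q - Y v = k * (Y p - Y v).
Proof.
move=> eirr pl evp evq pq A0.
have neq x : e v x -> v <> x by move=> evx E; rewrite -E eirr in evx.
have [|k [E1 E2]] := collinear_scale A0.
  apply: contrapT => h; apply: (neq p evp); apply: (planar_inj pl); apply: contrapT => h'.
    by apply: h; left; lra.
  by apply: h; right; lra.
exists k => //; rewrite ltNge; apply/negP; rewrite le_eqVlt => /orP[/eqP k0|k0].
  by apply: (neq q evq); apply: (planar_inj pl); rewrite -k0 in E1 E2; lra.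
have [k1|k1] := lerP k 1.
  have [|E|E] := planar_vertex pl (w := q) evp; last by apply: pq.
    by exists k; [lra|split; lra].
  by apply: (neq q evq).
have [|E|E] := planar_vertex pl (w := p) evq; last by apply: pq.
  exists k^-1; first by rewrite invr_ge0 invf_le1 ?ltW.
  have kn := lt0r_neq0 k0.
  rewrite (_ : X q = X v + k * (X p - X v)); last by lra.
  rewrite (_ : Y q = Y v + k * (Y p - Y v)); last by lra.
  by split; field.
by apply: (neq p evp).
Qed.

Lemma corner_or_interior (R : realFieldType) (V : finType) (e : rel V)
    (X Y : V -> R) (a b c v : V) :
  planar e X Y -> hull_triangle e X Y a b c ->
  [\/ v = a, v = b | v = c] \/
  [/\ 0 < area X Y a b v, 0 < area X Y b c v & 0 < area X Y c a v].
Proof.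
move=> pl [eab ebc eca D0 tri]; have [h1 h2 h3] := tri v.
have [E1|n1] := eqVneq (area X Y a b v) 0.
  have o := on_side D0 E1 h2 h3.
  by left; case: (planar_vertex pl eab o) => ->; [exact: Or31|exact: Or32].
have [E2|n2] := eqVneq (area X Y b c v) 0.
  rewrite -area_rot in D0; have o := on_side D0 E2 h3 h1.
  by left; case: (planar_vertex pl ebc o) => ->; [exact: Or32|exact: Or33].
have [E3|n3] := eqVneq (area X Y c a v) 0.
  rewrite -2!area_rot in D0; have o := on_side D0 E3 h1 h2.
  by left; case: (planar_vertex pl eca o) => ->; [exact: Or33|exact: Or31].
by right; split; rewrite lt_neqAle eq_sym ?n1 ?n2 ?n3.
Qed.

(* The neighbours of an inner vertex positively span the plane. *)
Lemma inner_higher_neighbor (R : realFieldType) (V : finType) (e : rel V)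
    (X Y : V -> R) (a b c v : V) (f g : R) :
  symmetric e -> planar e X Y -> saturated e X Y -> hull_triangle e X Y a b c ->
  [/\ 0 < area X Y a b v, 0 < area X Y b c v & 0 < area X Y c a v] ->
  f <> 0 \/ g <> 0 -> exists2 w, e v w & f * X v + g * Y v < f * X w + g * Y w.
Proof.
move=> esym pl sat [_ _ _ D0 _] [p1 p2 p3] fg; apply: higher_neighbor => //.
apply: contrapT => h.
have le x : 0 <= (f * X v + g * Y v) - (f * X x + g * Y x).
  by rewrite subr_ge0 leNgt; apply/negP => lt; apply: h; exists x.
have bary : area X Y b c v * ((f * X v + g * Y v) - (f * X a + g * Y a)) +
   area X Y c a v * ((f * X v + g * Y v) - (f * X b + g * Y b)) +
   area X Y a b v * ((f * X v + g * Y v) - (f * X c + g * Y c)) = 0.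
  by rewrite /area /side; ring.
have ha := le a; have hb := le b; have hc := le c.
have Ea : (f * X v + g * Y v) - (f * X a + g * Y a) = 0.
  by clear -ha hb hc p1 p2 p3 bary; nra.
have Eb : (f * X v + g * Y v) - (f * X b + g * Y b) = 0.
  by clear -ha hb hc p1 p2 p3 bary; nra.
have Ec : (f * X v + g * Y v) - (f * X c + g * Y c) = 0.
  by clear -ha hb hc p1 p2 p3 bary; nra.
have Ef : f * area X Y a b c = 0.
  transitivity ((Y c - Y a) * (f * (X b - X a) + g * (Y b - Y a)) -
    (Y b - Y a) * (f * (X c - X a) + g * (Y c - Y a))); first by rewrite /area /side; ring.
  have -> : f * (X b - X a) + g * (Y b - Y a) = 0 by clear -Ea Eb; lra.
  have -> : f * (X c - X a) + g * (Y c - Y a) = 0 by clear -Ea Ec; lra.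
  by ring.
have Eg : g * area X Y a b c = 0.
  transitivity ((X b - X a) * (f * (X c - X a) + g * (Y c - Y a)) -
    (X c - X a) * (f * (X b - X a) + g * (Y b - Y a))); first by rewrite /area /side; ring.
  have -> : f * (X b - X a) + g * (Y b - Y a) = 0 by clear -Ea Eb; lra.
  have -> : f * (X c - X a) + g * (Y c - Y a) = 0 by clear -Ea Ec; lra.
  by ring.
by case: fg; apply; [move/eqP: Ef|move/eqP: Eg]; rewrite mulf_eq0 (gt_eqF D0) orbF => /eqP.
Qed.

(* Connectivity is stated through cuts [A]; here it is that of the neighbourhood
   of [v] without [w]. *)
Definition link_connected (V : finType) (e : rel V) : Prop :=
  forall (v w : V) (A : pred V) p q, e v p -> e v q -> p <> w -> q <> w ->
    A p -> ~~ A q ->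
    exists p' q', [/\ e v p' /\ p' <> w, e v q' /\ q' <> w, A p', ~~ A q' & e p' q'].

Definition joined (V : finType) (e : rel V) : Prop :=
  forall (A : pred V) a b, A a -> ~~ A b -> exists a' b', [/\ A a', ~~ A b' & e a' b'].

(** The case [s = t] is included, so a single deleted vertex is covered too. *)
Definition two_joined (V : finType) (e : rel V) : Prop :=
  forall (s t : V) (A : pred V) a b, A a -> ~~ A b ->
    a <> s /\ a <> t -> b <> s /\ b <> t ->
    exists a' b', [/\ A a', ~~ A b', a' <> s /\ a' <> t, b' <> s /\ b' <> t & e a' b'].

(** On the side of the cut that misses the extreme vertex [m], the vertex highest in the direction
    of [m] still has a higher neighbour, which must lie across the cut. *)
Lemma saturated_joined (R : realFieldType) (V : finType) (e : rel V) (X Y : V -> R) :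
  symmetric e -> planar e X Y -> saturated e X Y -> joined e.
Proof.
move=> esym pl sat A a b Aa Ab.
have [|m [f [g se]]] := ex_strictly_extreme pl; first by apply/card_gt0P; exists a.
have step (B : pred V) z0 : B m -> ~~ B z0 -> exists z y, [/\ ~~ B z, B y & e z y].
  move=> Bm Bz0.
  have [|z Bz zmax] := @ex_argmin R V (fun z => ~~ B z) (fun z => - (f * X z + g * Y z)).
    by exists z0.
  have [|y ezy lt] := @higher_neighbor R V e X Y f g z esym pl sat.
    by exists m; apply: se => E; rewrite E Bm in Bz.
  exists z, y; split=> //; apply: contrapT => /negP/zmax.
  by clear -lt; lra.
case: (boolP (A m)) => Am.
  have [z [y [Az Ay ezy]]] := step A b Am Ab.
  by exists y, z; split=> //; rewrite esym.
have nAa : ~~ predC A a by rewrite /= Aa.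
have [z [y [Az Ay ezy]]] := step (predC A) a Am nAa.
by exists z, y; split=> //; rewrite -[A z]negbK.
Qed.

(** Let [s] and [t] separate [A'] from [B']. If one of them has neighbours on both sides, its link
    without the other is connected and contains an edge between the sides. Otherwise each of them
    touches one side only and connectedness forces the edge [s t]; the link of [s] then contains [t]
    and vertices on the side of [s], so it joins [t] to that side. *)
Lemma link_two_joined (V : finType) (e : rel V) :
  symmetric e -> irreflexive e -> joined e -> link_connected e -> two_joined e.
Proof.
move=> esym eirr jn lk s t A a b Aa Ab [as' at'] [bs bt].
apply: contrapT => h.
pose A' : pred V := fun x => [&& A x, x != s & x != t].
pose B' : pred V := fun x => [&& ~~ A x, x != s & x != t].
have noAB x y : A' x -> B' y -> e x y -> False.
  move=> /and3P[Ax /eqP xs /eqP xt] /and3P[Ay /eqP ys /eqP yt] exy.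
  by apply: h; exists x, y.
have A'a : A' a by apply/and3P; split=> //; apply/eqP.
have B'b : B' b by apply/and3P; split=> //; apply/eqP.
have cover x : [\/ A' x, B' x, x = s | x = t].
  rewrite /A' /B'; case: (eqVneq x s) => [->|_]; first exact: Or43.
  case: (eqVneq x t) => [->|_]; first exact: Or44.
  by rewrite !andbT; case: (A x); [exact: Or41|exact: Or42].
have A's x : A' x -> x <> s by case/and3P => _ /eqP.
have A't x : A' x -> x <> t by case/and3P => _ _ /eqP.
have B's x : B' x -> x <> s by case/and3P => _ /eqP.
have B't x : B' x -> x <> t by case/and3P => _ _ /eqP.
have A'B' x : A' x -> B' x -> False by case/and3P => Ax _ _ /and3P[]; rewrite Ax.
have both c d : (forall x, A' x -> x <> c) -> (forall x, B' x -> x <> c) ->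
    (forall x, A' x -> x <> d) -> (forall x, B' x -> x <> d) ->
    (forall x, [\/ A' x, B' x, x = c | x = d]) ->
    (exists2 x, A' x & e c x) -> (exists2 y, B' y & e c y) -> False.
  move=> Ac Bc Ad Bd cov [x Ax ecx] [y By ecy].
  have [||||p [q [[_ _] [ecq qd] Ap Aq epq]]] := lk c d A' x y ecx ecy.
  - exact: Ad.
  - exact: Bd.
  - by [].
  - by apply/negP => Ay; exact: (A'B' y).
  case: (cov q) => [Aq'|Bq|E|//]; first by rewrite Aq' in Aq.
  - exact: (noAB p q).
  - by rewrite E eirr in ecq.
have nots := both s t A's B's A't B't cover.
have nott : (exists2 x, A' x & e t x) -> (exists2 y, B' y & e t y) -> False.
  apply: (both t s A't B't A's B's) => x.
  by case: (cover x) => ?; [exact: Or41|exact: Or42|exact: Or44|exact: Or43].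
have adjA : (exists2 x, A' x & e s x) \/ (exists2 x, A' x & e t x).
  have [|p [q [Ap Aq epq]]] := jn A' a b A'a; first by apply/negP => /A'B'/(_ B'b).
  case: (cover q) => [Aq'|Bq|E|E]; first by rewrite Aq' in Aq.
  - by case: (noAB p q).
  - by left; exists p => //; rewrite esym -E.
  - by right; exists p => //; rewrite esym -E.
have adjB : (exists2 x, B' x & e s x) \/ (exists2 x, B' x & e t x).
  have [|p [q [Bp Bq epq]]] := jn B' b a B'b; first by apply/negP => /(A'B' _ A'a).
  case: (cover q) => [Aq|Bq'|E|E]; last 2 first.
  - by left; exists p => //; rewrite esym -E.
  - by right; exists p => //; rewrite esym -E.
  - by rewrite esym in epq; case: (noAB q p).
  - by rewrite Bq' in Bq.
have mixed c d : (forall x, A' x -> x <> d) -> c <> d ->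
    (forall x, B' x -> x <> c) ->
    (forall x, [\/ A' x, B' x, x = c | x = d]) ->
    (exists2 x, A' x & e c x) -> (exists2 y, B' y & e d y) ->
    ((exists2 y, B' y & e c y) -> False) -> ((exists2 x, A' x & e d x) -> False) -> False.
  move=> Ad cd Bc cov cA dB cB dA.
  have [||p [q [/orP Ap Aq epq]]] := jn (fun x => A' x || (x == c)) a b.
  - by rewrite A'a.
  - rewrite negb_or; apply/andP; split; last by apply/eqP; exact: Bc.
    by apply/negP => /A'B'/(_ B'b).
  move: Aq; rewrite negb_or => /andP[Aq /eqP qc].
  have {}Ap : A' p \/ p = c by case: Ap => [|/eqP]; [left|right].
  case: (cov q) => [Aq'|Bq|//|qd]; first by rewrite Aq' in Aq.
    case: Ap => [Ap|pc]; first exact: (noAB p q).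
    by apply: cB; exists q => //; rewrite -pc.
  case: Ap => [Ap|pc]; first by apply: dA; exists p => //; rewrite esym -qd.
  subst p q; have [x Ax ecx] := cA.
  (* Removing [c] from its own neighbourhood removes nothing, so this is the connectivity of the
     whole link. *)
  have [||||p [q [[ecp _] [ecq _] Ap Aq' epq']]] := lk c c A' x d ecx epq.
  - by move=> E; rewrite E eirr in ecx.
  - by move=> E; apply: cd.
  - by [].
  - by apply/negP => /Ad.
  case: (cov q) => [Aq2|Bq|E|E]; first by rewrite Aq2 in Aq'.
  - exact: (noAB p q).
  - by rewrite E eirr in ecq.
  - by apply: dA; exists p => //; rewrite esym -E.
have cover' x : [\/ A' x, B' x, x = t | x = s].
  by case: (cover x) => ?; [exact: Or41|exact: Or42|exact: Or44|exact: Or43].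
case: adjA => [sA|tA]; case: adjB => [sB|tB].
- exact: nots.
- apply: (mixed s t) => //; [|by move=> sB; exact: nots|by move=> tA; exact: nott].
  by move=> E; subst t; exact: nots.
- apply: (mixed t s) => //; [|by move=> tB; exact: nott|by move=> sA; exact: nots].
  by move=> E; subst t; exact: nots.
- exact: nott.
Qed.

(** The three-term Plücker relation for the vectors from [v]. When the other areas are positive it
    yields the sign of the remaining one, which replaces arguments about angular order. *)
Lemma area_plucker (R : realFieldType) (V : finType) (X Y : V -> R) (v p x y q : V) :
  area X Y v p y * area X Y v x q =
  area X Y v p x * area X Y v y q + area X Y v p q * area X Y v x y.
Proof. by rewrite /area /side; ring. Qed.

(** Induction on the number of neighbours in the wedge. There is one, [x], for otherwise [p] and [q]
    would be adjacent. If [x] is not [w], it differs under [A] from [p] or from [q] and bounds a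
    smaller wedge with it. *)
Lemma wedge_contains_cut (R : realFieldType) (V : finType) (e : rel V) (X Y : V -> R)
    (v w : V) (A : pred V) :
  symmetric e -> planar e X Y -> saturated e X Y ->
  (forall p q, e v p -> e v q -> p <> w -> q <> w -> A p != A q -> ~~ e p q) ->
  forall p q, e v p -> e v q -> p <> w -> q <> w -> A p != A q -> 0 < area X Y v p q ->
  [/\ e v w, 0 < area X Y v p w & 0 < area X Y v w q].
Proof.
move=> esym pl sat ne p q.
pose W p q := [set x | [&& e v x, 0 < area X Y v p x & 0 < area X Y v x q]]%SET.
have [n] := ubnP #|W p q|; elim: n p q => // n IH p q Wn evp evq pw qw Apq D0.
have [x] : exists x, x \in W p q.
  apply: contrapT => h; have := ne p q evp evq pw qw Apq; apply/negP; rewrite negbK.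
  apply: (wedge_adjacent esym pl sat evp evq D0) => x evx h1 h2.
  by apply: h; exists x; rewrite inE evx h1 h2.
rewrite inE => /and3P[evx h1 h2].
have [xw|/eqP xw] := eqVneq x w; first by subst x.
have Axx : area X Y v x x = 0 by rewrite /area /side; ring.
have xW : x \in W p q by rewrite inE evx h1 h2.
have [Apx|Apx] := eqVneq (A p) (A x).
  have sub : W x q \subset W p q :\ x.
    apply/fintype.subsetP => y; rewrite !inE => /and3P[evy y1 y2].
    rewrite evy y2 !andbT; apply/andP; split.
      by apply/eqP => E; rewrite E Axx ltxx in y1.
    have pk := area_plucker X Y v p x y q.
    have s1 := mulr_gt0 h1 y2; have s2 := mulr_gt0 D0 y1.
    by rewrite -(pmulr_lgt0 _ h2) pk addr_gt0.
  have [||e1 e2 e3] := IH x q _ evx evq xw qw _ h2.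
  - apply: (leq_ltn_trans (subset_leq_card sub)).
    by move: Wn; rewrite (cardsD1 x (W p q)) xW ltnS.
  - by rewrite -Apx.
  split=> //; rewrite -(pmulr_lgt0 _ h2) (area_plucker X Y v p x w q).
  by rewrite addr_gt0 ?mulr_gt0.
have sub : W p x \subset W p q :\ x.
  apply/fintype.subsetP => y; rewrite !inE => /and3P[evy y1 y2].
  rewrite evy y1 /=; apply/andP; split.
    by apply/eqP => E; rewrite E Axx ltxx in y2.
  rewrite -(pmulr_rgt0 _ h1) (_ : _ * _ = area X Y v p y * area X Y v x q +
     area X Y v p q * area X Y v y x); last by rewrite /area /side; ring.
  by rewrite addr_gt0 ?mulr_gt0.
have [||e1 e2 e3] := IH p x _ evp evx pw xw _ h1.
- apply: (leq_ltn_trans (subset_leq_card sub)).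
  by move: Wn; rewrite (cardsD1 x (W p q)) xW ltnS.
- by [].
split=> //; rewrite -(pmulr_rgt0 _ h1) (_ : _ * _ = area X Y v p w * area X Y v x q +
   area X Y v p q * area X Y v w x); last by rewrite /area /side; ring.
by rewrite addr_gt0 ?mulr_gt0.
Qed.

Lemma hull_triangle_rot (R : realFieldType) (V : finType) (e : rel V)
    (X Y : V -> R) (a b c : V) :
  hull_triangle e X Y a b c -> hull_triangle e X Y b c a.
Proof.
move=> [eab ebc eca D0 tri]; split=> //; first by rewrite area_rot.
by move=> x; have [] := tri x.
Qed.

(** All neighbours of [v] lie in the wedge from [b] to [c]. If [w] is [b] or [c], it is strictly
    inside no smaller wedge. Otherwise [A b = A c], because [b] and [c] are adjacent, and a
    neighbour [z] of the other class would have [w] both between [b] and [z] and between [z] and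
    [c]. *)
Lemma corner_link (R : realFieldType) (V : finType) (e : rel V) (X Y : V -> R)
    (v b c w : V) (A : pred V) (p q : V) :
  symmetric e -> irreflexive e -> planar e X Y -> saturated e X Y ->
  hull_triangle e X Y v b c ->
  (forall p q, e v p -> e v q -> p <> w -> q <> w -> A p != A q -> ~~ e p q) ->
  e v p -> e v q -> p <> w -> q <> w -> A p != A q -> False.
Proof.
move=> esym eirr pl sat [evb ebc ecv D0 tri] ne evp evq pw qw Apq.
have evc : e v c by rewrite esym.
have cvE x : area X Y c v x = area X Y v x c by rewrite -area_rot.
have claim := wedge_contains_cut esym pl sat ne.
have opp x y : e v x -> e v y -> x <> y -> area X Y v x y = 0 -> False.
  move=> evx evy xy A0.
  have [k k0 [E1 E2]] := collinear_neighbors eirr pl evx evy xy A0.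
  have [x1 _ x3] := tri x; have [y1 _ y3] := tri y.
  have yE := areaZ b E1 E2; have yE' := areaZ c E1 E2.
  rewrite !cvE in x3 y3.
  rewrite areaN in x3; rewrite areaN yE' in y3; rewrite yE in y1.
  have xb0 : area X Y v b x = 0 by clear -k0 x1 y1; nra.
  have xc0 : area X Y v c x = 0 by clear -k0 x3 y3; nra.
  have [xb|/eqP xb] := eqVneq x b.
    by subst x; rewrite areaN in xc0; clear -xc0 D0; lra.
  have bx : b <> x by move=> E; apply: xb.
  have [k' k'0 [F1 F2]] := collinear_neighbors eirr pl evb evx bx xb0.
  by rewrite (areaZ c F1 F2) areaN in xc0; clear -xc0 k'0 D0; nra.
have pos x y : e v x -> e v y -> x <> y -> 0 <= area X Y v x y -> 0 < area X Y v x y.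
  move=> evx evy xy ge; rewrite lt_neqAle ge andbT; apply/eqP => E.
  by apply: (opp x y).
have [bw|/eqP bw] := eqVneq b w.
  have side' x y : e v x -> e v y -> x <> w -> y <> w -> A x != A y ->
      0 < area X Y v x y -> False.
    move=> evx evy xw yw Axy lt; have [_ h _] := claim x y evx evy xw yw Axy lt.
    by have [h' _ _] := tri x; rewrite -bw areaN in h; clear -h h'; lra.
  have pq : p <> q by move=> E; rewrite E eqxx in Apq.
  have [lt|lt|E] := ltgtP 0 (area X Y v p q).
  - exact: (side' p q).
  - apply: (side' q p) => //; first by rewrite eq_sym.
    by rewrite areaN; clear -lt; lra.
  - by apply: (opp p q).
have [cw|/eqP cw] := eqVneq c w.
  have side' x y : e v x -> e v y -> x <> w -> y <> w -> A x != A y ->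
      0 < area X Y v x y -> False.
    move=> evx evy xw yw Axy lt; have [_ _ h] := claim x y evx evy xw yw Axy lt.
    by have [_ _ h'] := tri y; rewrite cvE in h'; rewrite -cw areaN in h; clear -h h'; lra.
  have pq : p <> q by move=> E; rewrite E eqxx in Apq.
  have [lt|lt|E] := ltgtP 0 (area X Y v p q).
  - exact: (side' p q).
  - apply: (side' q p) => //; first by rewrite eq_sym.
    by rewrite areaN; clear -lt; lra.
  - by apply: (opp p q).
have Abc : A b = A c.
  by apply/eqP; apply: contraT => /(ne b c evb evc bw cw); rewrite ebc.
have [z [evz zw Az]] : exists z, [/\ e v z, z <> w & A b != A z].
  have [E|n] := eqVneq (A b) (A p); last by exists p.
  by exists q; split=> //; rewrite E.
have bz : b <> z by move=> E; rewrite E eqxx in Az.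
have zc : z <> c by move=> E; rewrite Abc E eqxx in Az.
have [h1 _ h2] := tri z; rewrite cvE in h2.
have [_ _ l1] := claim b z evb evz bw zw Az (pos b z evb evz bz h1).
have Azc : A z != A c by rewrite -Abc eq_sym.
have [_ l2 _] := claim z c evz evc zw cw Azc (pos z c evz evc zc h2).
by rewrite areaN in l2; clear -l1 l2; lra.
Qed.

(** If [w] lies in a wedge between the two classes of [A], the line [v w] separates them. Beyond the
    last neighbour [x'] of the right-hand class there is, by spanning, a neighbour [u] of the other
    class, and the wedge from [u] to [x'] misses [w]. *)
Lemma inner_link (R : realFieldType) (V : finType) (e : rel V) (X Y : V -> R)
    (v w : V) (A : pred V) (p q : V) :
  symmetric e -> irreflexive e -> planar e X Y -> saturated e X Y ->
  (forall f g : R, f <> 0 \/ g <> 0 ->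
    exists2 u, e v u & f * X v + g * Y v < f * X u + g * Y u) ->
  (forall p q, e v p -> e v q -> p <> w -> q <> w -> A p != A q -> ~~ e p q) ->
  e v p -> e v q -> p <> w -> q <> w -> A p != A q -> False.
Proof.
move=> esym eirr pl sat span ne evp evq pw qw Apq.
have claim := wedge_contains_cut esym pl sat ne.
have spanA x : e v x -> exists2 u, e v u & area X Y v x u < 0.
  move=> evx; have [|u evu lt] := span (Y x - Y v) (- (X x - X v)).
    apply: contrapT => h; have vx : v = x.
      by apply: (planar_inj pl); apply: contrapT => h'; apply: h; [right|left]; lra.
    by rewrite -vx eirr in evx.
  by exists u => //; rewrite /area /side; clear -lt; lra.
have spanA' x : e v x -> exists2 u, e v u & 0 < area X Y v x u.
  move=> evx; have [|u evu lt] := span (- (Y x - Y v)) (X x - X v).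
    apply: contrapT => h; have vx : v = x.
      by apply: (planar_inj pl); apply: contrapT => h'; apply: h; [right|left]; lra.
    by rewrite -vx eirr in evx.
  by exists u => //; rewrite /area /side; clear -lt; lra.
have noncol x y : e v x -> e v y -> x <> w -> y <> w -> A x != A y ->
    0 < area X Y v x y -> False.
  move=> evx evy xw yw Axy lt.
  have [evw xw0 wy0] := claim x y evx evy xw yw Axy lt.
  have right_ z : e v z -> z <> w -> A z = A x -> area X Y v w z < 0.
    move=> evz zw Az; have Azy : A z != A y by rewrite Az.
    have [l|l|E] := ltgtP 0 (area X Y v z y).
    - have [_ h _] := claim z y evz evy zw yw Azy l.
      by rewrite areaN; clear -h; lra.
    - have Ayz : A y != A z by rewrite eq_sym.
      have [|_ h _] := claim y z evy evz yw zw Ayz; first by rewrite areaN; clear -l; lra.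
      by rewrite areaN in h; clear -h wy0; lra.
    - have yz : y <> z by move=> E'; rewrite E' eqxx in Azy.
      have [|k k0 [E1 E2]] := collinear_neighbors eirr pl evy evz yz.
        by rewrite areaN -E oppr0.
      by rewrite (areaZ w E1 E2); clear -k0 wy0; nra.
  have left_ z : e v z -> z <> w -> A z != A x -> 0 < area X Y v w z.
    move=> evz zw Az; have Axz : A x != A z by rewrite eq_sym.
    have [l|l|E] := ltgtP 0 (area X Y v x z).
    - by have [] := claim x z evx evz xw zw Axz l.
    - have [|_ _ h] := claim z x evz evx zw xw Az; first by rewrite areaN; clear -l; lra.
      by rewrite areaN in h; clear -h xw0; lra.
    - have xz : x <> z by move=> E'; rewrite E' eqxx in Az.
      have [k k0 [E1 E2]] := collinear_neighbors eirr pl evx evz xz (Logic.eq_sym E).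
      by rewrite (areaZ w E1 E2) areaN; clear -k0 xw0; nra.
  pose d z := (X z - X v) * (X w - X v) + (Y z - Y v) * (Y w - Y v).
  (* The quotient is the cotangent of the clockwise angle from [w] to [z], so [x'] is the last of
     its class in clockwise order. *)
  have [|x' [evx' x'w Ax'] xmin] := @ex_argmin R V
      (fun z => [/\ e v z, z <> w & A z = A x]) (fun z => d z / - area X Y v w z).
    by exists x.
  have sx' := right_ x' evx' x'w Ax'.
  have [u evu lt'] := spanA x' evx'.
  have [uw|/eqP uw] := eqVneq u w.
    by subst u; rewrite areaN in lt'; clear -sx' lt'; lra.
  have [Au|Au] := eqVneq (A u) (A x).
    have su := right_ u evu uw Au.
    have := xmin u (And3 evu uw Au); rewrite ler_pdivrMr ?oppr_gt0 // mulrAC.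
    rewrite ler_pdivlMr ?oppr_gt0 //.
    have -> : (d x' * - area X Y v w u <= d u * - area X Y v w x') =
       (0 <= (d x' * area X Y v w u - d u * area X Y v w x')).
      by rewrite -subr_ge0; congr (0 <= _); ring.
    have -> : d x' * area X Y v w u - d u * area X Y v w x' =
       area X Y v x' u * ((X w - X v) * (X w - X v) + (Y w - Y v) * (Y w - Y v)).
      by rewrite /d /area /side; ring.
    rewrite leNgt => /negP; apply; rewrite nmulr_rlt0 // lt_neqAle.
    apply/andP; split; last by rewrite addr_ge0 // -expr2 sqr_ge0.
    rewrite eq_sym; apply/eqP => /sum_squares0 [E1 E2].
    by move: sx'; rewrite /area /side E1 E2; clear; lra.
  have := left_ u evu uw Au.
  have Aux : A u != A x' by rewrite Ax'.
  have [_ _ h] : [/\ e v w, 0 < area X Y v u w & 0 < area X Y v w x'].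
    by apply: claim => //; rewrite areaN; clear -lt'; lra.
  by move: h; clear -sx'; lra.
have Aqp : A q != A p by rewrite eq_sym.
(* It remains that neighbours of different classes are always collinear with [v]. Then all
   neighbours except [w] lie on one line, but spanning requires one strictly on each side of it. *)
have col x y : e v x -> e v y -> x <> w -> y <> w -> A x != A y -> area X Y v x y = 0.
  move=> evx evy xw yw Axy; have Ayx : A y != A x by rewrite eq_sym.
  have [lt|lt|//] := ltgtP 0 (area X Y v x y); first by case: (noncol x y).
  by case: (noncol y x) => //; rewrite areaN; clear -lt; lra.
have pq : p <> q by move=> E; rewrite E eqxx in Apq.
have [k k0 [E1 E2]] := collinear_neighbors eirr pl evp evq pq (col p q evp evq pw qw Apq).
have only u : e v u -> area X Y v p u <> 0 -> u = w.
  move=> evu nz; apply: contrapT => uw; apply: nz.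
  have [Au|Au] := eqVneq (A p) (A u); last exact: col.
  have Auq : A u != A q by rewrite -Au.
  have := col u q evu evq uw qw Auq; rewrite (areaZ u E1 E2) => /eqP.
  rewrite mulf_eq0 (lt_eqF k0) /= => /eqP h.
  by rewrite areaN h oppr0.
have [u evu lu] := spanA p evp; have [u' evu' lu'] := spanA' p evp.
have Eu : u = w by apply: only => // h; rewrite h ltxx in lu.
have Eu' : u' = w by apply: only => // h; rewrite h ltxx in lu'.
by subst u u'; clear -lu lu'; lra.
Qed.

Lemma saturated_link_connected (R : realFieldType) (V : finType) (e : rel V)
    (X Y : V -> R) (a b c : V) :
  symmetric e -> irreflexive e -> planar e X Y -> saturated e X Y ->
  hull_triangle e X Y a b c -> link_connected e.
Proof.
move=> esym eirr pl sat hull v w A p q evp evq pw qw Ap Aq.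
apply: contrapT => h.
have ne p' q' : e v p' -> e v q' -> p' <> w -> q' <> w -> A p' != A q' -> ~~ e p' q'.
  move=> e1 e2 w1 w2 A12; apply/negP => epq; apply: h.
  case Ap' : (A p') A12; case Aq' : (A q') => // _.
    by exists p', q'; split=> //; rewrite Aq'.
  by exists q', p'; split=> //; rewrite ?Ap' // esym.
have Apq : A p != A q by rewrite Ap (negbTE Aq).
case: (corner_or_interior v pl hull) => [[E|E|E]|int].
- by subst v; exact: (corner_link esym eirr pl sat hull ne evp evq).
- by subst v; exact: (corner_link esym eirr pl sat (hull_triangle_rot hull) ne evp evq).
- by subst v; exact: (corner_link esym eirr pl sat
    (hull_triangle_rot (hull_triangle_rot hull)) ne evp evq).
- apply: (inner_link esym eirr pl sat _ ne evp evq) => // f g fg.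
  exact: (inner_higher_neighbor esym pl sat hull int fg).
Qed.

(** * The outer triangle of an arbitrary drawing *)

Lemma below_chord (R : realFieldType) (V : finType) (e : rel V) (X Y : V -> R)
    (v x p q : V) :
  planar e X Y -> e v x -> e p q ->
  0 < area X Y v p x -> 0 < area X Y v x q -> 0 < area X Y v p q -> 0 < area X Y p q x.
Proof.
move=> pl evx epq px xq pq; rewrite ltNge; apply/negP => le.
have D0 : 0 < area X Y p q v by rewrite area_rot.
pose d := area X Y p q v - area X Y p q x.
have d0 : 0 < d by rewrite /d; clear -D0 le; lra.
pose t := area X Y p q v / d.
have tE : t * d = area X Y p q v by rewrite /t mulfVK // lt0r_neq0.
have t0 : 0 < t by exact: divr_gt0.
have t1 : t <= 1 by rewrite /t ler_pdivrMr // /d; clear -le; lra.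
have o1 : on_seg X Y v x ((1 - t) * X v + t * X x) ((1 - t) * Y v + t * Y x).
  by exists t => //; clear -t0 t1; lra.
have o2 : on_seg X Y p q ((1 - t) * X v + t * X x) ((1 - t) * Y v + t * Y x).
  apply: (on_side D0).
  - transitivity (area X Y p q v - t * d); last by rewrite tE subrr.
    by rewrite /d /area /side; ring.
  - have -> : side X Y q v ((1 - t) * X v + t * X x) ((1 - t) * Y v + t * Y x) =
       t * area X Y v x q by rewrite /area /side; ring.
    by rewrite ltW // mulr_gt0.
  - have -> : side X Y v p ((1 - t) * X v + t * X x) ((1 - t) * Y v + t * Y x) =
       t * area X Y v p x by rewrite /area /side; ring.
    by rewrite ltW // mulr_gt0.
have Avx z : area X Y v v z = 0 by rewrite /area /side; ring.
have Axv z : area X Y v z v = 0 by rewrite /area /side; ring.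
have Axx z : area X Y v z z = 0 by rewrite /area /side; ring.
case: (planar_cross pl evx epq o1 o2) => [[E1 E2]|[E1 E2]|[w [w1 w2 _ _]]].
- by subst p; rewrite Avx ltxx in px.
- by subst q; rewrite Axv ltxx in xq.
- case: w1 => E; subst w; case: w2 => E.
  + by rewrite -E Avx ltxx in px.
  + by rewrite -E Axv ltxx in xq.
  + by rewrite -E Axx ltxx in px.
  + by rewrite -E Axx ltxx in xq.
Qed.

(** Around [v] the order is [u], [x], [b], [y]. By [below_chord], [x] lies below the chord [u b] and
    [b] below the chord [x y]; a Plücker relation then puts [y] beyond [u b], so the chords
    cross. *)
Lemma chords_cross (R : realFieldType) (V : finType) (e : rel V) (X Y : V -> R)
    (v u x b y : V) :
  planar e X Y -> e v x -> e v b -> e u b -> e x y ->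
  0 < area X Y v u x -> 0 < area X Y v u b -> 0 < area X Y v u y ->
  0 < area X Y v x b -> 0 < area X Y v x y -> 0 < area X Y v b y -> False.
Proof.
move=> pl evx evb eub exy ux ub uy xb xy by_.
have al := below_chord pl evx eub ux xb ub.
have ga := below_chord pl evb exy xb by_ xy.
have be : area X Y u b y < 0.
  rewrite -(pmulr_llt0 _ xb).
  have -> : area X Y u b y * area X Y v x b =
    - (area X Y v u b * area X Y x y b + area X Y v b y * area X Y u b x).
    by rewrite /area /side; ring.
  by rewrite oppr_lt0 addr_gt0 ?mulr_gt0.
pose d := area X Y u b x - area X Y u b y.
have d0 : 0 < d by rewrite /d; clear -al be; lra.
pose t := area X Y u b x / d.
have tE : t * d = area X Y u b x by rewrite /t mulfVK // lt0r_neq0.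
have t0 : 0 < t by exact: divr_gt0.
have t1 : t < 1 by rewrite /t ltr_pdivrMr // /d; clear -be; lra.
have o1 : on_seg X Y x y ((1 - t) * X x + t * X y) ((1 - t) * Y x + t * Y y).
  by exists t => //; clear -t0 t1; lra.
have o2 : on_seg X Y u b ((1 - t) * X x + t * X y) ((1 - t) * Y x + t * Y y).
  apply: (on_side (c := v)); first by rewrite area_rot.
  - transitivity (area X Y u b x - t * d); last by rewrite tE subrr.
    by rewrite /d /area /side; ring.
  - have -> : side X Y b v ((1 - t) * X x + t * X y) ((1 - t) * Y x + t * Y y) =
       (1 - t) * area X Y v x b - t * area X Y v b y by rewrite /area /side; ring.
    rewrite ltW // -(pmulr_lgt0 _ d0).
    have -> : ((1 - t) * area X Y v x b - t * area X Y v b y) * d =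
      (d - t * d) * area X Y v x b - (t * d) * area X Y v b y by ring.
    rewrite tE (_ : _ - _ = area X Y v u b * area X Y x y b) ?mulr_gt0 //.
    by rewrite /d /area /side; ring.
  - have -> : side X Y v u ((1 - t) * X x + t * X y) ((1 - t) * Y x + t * Y y) =
       (1 - t) * area X Y v u x + t * area X Y v u y by rewrite /area /side; ring.
    by rewrite addr_ge0 // mulr_ge0 ?ltW // subr_gt0.
have Axx z z' : area X Y z z' z = 0 by rewrite /area /side; ring.
have Axx' z z' : area X Y z z' z' = 0 by rewrite /area /side; ring.
case: (planar_cross pl exy eub o1 o2) => [[E1 E2]|[E1 E2]|[w [w1 w2 _ _]]].
- by subst x; rewrite Axx ltxx in al.
- by subst x; rewrite Axx' ltxx in al.
- case: w1 => E; subst w; case: w2 => E.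
  + by rewrite E Axx ltxx in al.
  + by rewrite E Axx' ltxx in al.
  + by rewrite E Axx ltxx in be.
  + by rewrite E Axx' ltxx in be.
Qed.

(** As [v] is leftmost, its neighbours are ordered by slope, with [u1] first and [u2] last. Once
    [u1 u2] is an edge, no edge at [v] crosses it, so all neighbours of [v] are in the triangle. *)
Lemma linked_hull_triangle_origin (R : realFieldType) (V : finType) (e : rel V)
    (X Y : V -> R) (v : V) :
  symmetric e -> irreflexive e -> planar e X Y ->
  joined e -> two_joined e -> link_connected e ->
  X v = 0 -> Y v = 0 -> (forall x, x <> v -> 0 < X x) -> (2 < #|V|)%N ->
  exists b c, hull_triangle e X Y v b c.
Proof.
move=> esym eirr pl jn tj lk Xv Yv Xpos V2.
have nbr x : e v x -> x <> v by move=> evx E; rewrite E eirr in evx.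
have AE x y : area X Y v x y = X x * Y y - Y x * X y by rewrite /area /side Xv Yv !subr0.
pose S x := Y x / X x.
have AS x y : e v x -> e v y -> (0 < area X Y v x y) = (S x < S y).
  move=> /nbr/Xpos Xx /nbr/Xpos Xy; rewrite AE subr_gt0 /S.
  by rewrite ltr_pdivrMr // mulrAC ltr_pdivlMr // [X x * _]mulrC.
have Sinj x y : e v x -> e v y -> S x = S y -> x = y.
  move=> evx evy E; apply: contrapT => xy.
  have A0 : area X Y v x y = 0.
    have h1 := AS x y evx evy; have h2 := AS y x evy evx.
    rewrite E ltxx in h1; rewrite E ltxx areaN in h2.
    have {}h1 : area X Y v x y <= 0 by rewrite leNgt h1.
    have {}h2 : - area X Y v x y <= 0 by rewrite leNgt h2.
    by clear -h1 h2; lra.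
  have [k k0 [E1 _]] := collinear_neighbors eirr pl evx evy xy A0.
  have := Xpos x (nbr x evx); have := Xpos y (nbr y evy).
  by rewrite Xv !subr0 in E1; rewrite E1; clear -k0; nra.
have Slt x y : e v x -> e v y -> x <> y -> S x <= S y -> S x < S y.
  by move=> evx evy xy le; rewrite lt_neqAle le andbT; apply/eqP => /(Sinj _ _ evx evy).
have [x0 evx0] : exists x, e v x.
  have [z [zv _]] := ex_third v v V2.
  have [|a' [b' [/eqP -> _ evb]]] := jn (pred1 v) v z (eqxx v); first exact/eqP.
  by exists b'.
have [|u1 ev1 min1] := @ex_argmin R V (fun x => e v x) S; first by exists x0.
have [|u2 ev2 max2] := @ex_argmin R V (fun x => e v x) (fun x => - S x); first by exists x0.
have u12 : u1 <> u2.
  move=> E; subst u2.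
  have all1 x : e v x -> x = u1.
    move=> evx; apply: Sinj => //; have := min1 x evx; have := max2 x evx; lra.
  have [z [zv zu]] := ex_third v u1 V2.
  have zv' : ~~ pred1 v z by exact/eqP.
  have vu : v <> u1 by move=> E; apply: (nbr u1).
  have [a' [b' [/eqP -> _ _ [bu _] evb]]] :=
    tj u1 u1 (pred1 v) v z (eqxx v) zv' (conj vu vu) (conj zu zu).
  by apply: bu; exact: all1.
have S12 : S u1 < S u2 by apply: Slt => //; exact: min1.
have D0 : 0 < area X Y v u1 u2 by rewrite AS.
(* Let [b] be the last neighbour of [v] adjacent to [u1]. If it is not [u2], the link of [v] without
   [b] has an edge from a slope below [S b] to one above. By the choice of [b] this edge does not
   start at [u1], and it crosses the chord [u1 b]. *)
have e12 : e u1 u2.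
  have [|b [evb e1b] bmax] := @ex_argmin R V (fun x => e v x /\ e u1 x) (fun x => - S x).
    have n21 : ~~ pred1 u1 u2 by apply/eqP => E; apply: u12.
    have [p' [q' [_ [evq _] /eqP -> _ e1q]]] :=
      lk v v (pred1 u1) u1 u2 ev1 ev2 (nbr _ ev1) (nbr _ ev2) (eqxx u1) n21.
    by exists q'.
  have [->//|/eqP b2] := eqVneq u2 b.
  have u1b : u1 <> b by move=> E; rewrite E eirr in e1b.
  have S1b : S u1 < S b by apply: Slt => //; exact: min1.
  have Sb2 : S b < S u2.
    apply: Slt => //; first by move=> E; apply: b2.
    by have := max2 b evb; lra.
  have [|x [y [[evx xb] [evy yb] /= Sx Sy exy]]] :=
    lk v b (fun z => S z < S b) u1 u2 ev1 ev2 u1b b2 S1b; first by rewrite -leNgt ltW.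
  have {}Sy : S b < S y.
    by apply: Slt => //; [move=> E; apply: yb|rewrite leNgt].
  have x1 : u1 <> x.
    by move=> E; subst x; have := bmax y (conj evy exy); lra.
  have S1x : S u1 < S x by apply: Slt => //; exact: min1.
  case: (chords_cross pl evx evb e1b exy); rewrite AS //.
  - exact: lt_trans Sy.
  - exact: lt_trans Sy.
have tri_nbr x : e v x ->
    [/\ 0 <= area X Y v u1 x, 0 <= area X Y u1 u2 x & 0 <= area X Y u2 v x].
  move=> evx.
  have [->|/eqP x1] := eqVneq x u1.
    rewrite (_ : area X Y u1 u2 u1 = 0); last by rewrite /area /side; ring.
    rewrite (_ : area X Y v u1 u1 = 0); last by rewrite /area /side; ring.
    by rewrite -area_rot lexx ltW.
  have [->|/eqP x2] := eqVneq x u2.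
    rewrite (_ : area X Y u1 u2 u2 = 0); last by rewrite /area /side; ring.
    rewrite (_ : area X Y u2 v u2 = 0); last by rewrite /area /side; ring.
    by rewrite lexx ltW.
  have h1 : 0 < area X Y v u1 x.
    by rewrite AS //; apply: Slt => //; [move=> E; apply: x1|exact: min1].
  have h2 : 0 < area X Y v x u2.
    by rewrite AS //; apply: Slt => //; have := max2 x evx; lra.
  have h3 := below_chord pl evx e12 h1 h2 D0.
  by split; [exact: ltW|exact: ltW|rewrite -area_rot ltW].
have tri_v : [/\ 0 <= area X Y v u1 v, 0 <= area X Y u1 u2 v & 0 <= area X Y u2 v v].
  rewrite (area_rot X Y v u1 u2) (_ : area X Y v u1 v = 0); last by rewrite /area /side; ring.
  rewrite (_ : area X Y u2 v v = 0); last by rewrite /area /side; ring.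
  by rewrite lexx ltW.
have e2v : e u2 v by rewrite esym.
exists u1, u2; split=> // x; apply: contrapT => nx.
pose A : pred V := fun z =>
  [&& 0 <= area X Y v u1 z, 0 <= area X Y u1 u2 z & 0 <= area X Y u2 v z].
have AP z : A z -> [/\ 0 <= area X Y v u1 z, 0 <= area X Y u1 u2 z & 0 <= area X Y u2 v z].
  by case/and3P.
have PA z : [/\ 0 <= area X Y v u1 z, 0 <= area X Y u1 u2 z & 0 <= area X Y u2 v z] -> A z.
  by move=> [h1 h2 h3]; apply/and3P.
have Ax : ~~ A x by apply/negP => /AP.
have A1 := PA u1 (tri_nbr u1 ev1); have A2 := PA u2 (tri_nbr u2 ev2); have Av := PA v tri_v.
have xs : x <> u1 /\ x <> u2 by split=> E; rewrite E ?A1 ?A2 in Ax.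
have vs : v <> u1 /\ v <> u2 by split=> E; [apply: (nbr u1)|apply: (nbr u2)].
(* This edge leaves the triangle and avoids [u1] and [u2]. It does not start at [v] either, whose
   neighbours are inside, so it would cross a side without sharing an endpoint. *)
have [a' [b' [Aa Ab [a1 a2] [b1 b2] eab]]] := tj u1 u2 A v x Av Ax vs xs.
have av : a' <> v by move=> E; subst a'; rewrite (PA b' (tri_nbr b' eab)) in Ab.
have nb : ~ [/\ 0 <= area X Y v u1 b', 0 <= area X Y u1 u2 b' & 0 <= area X Y u2 v b'].
  by move/PA; apply/negP.
have bv : b' <> v by move=> E; subst b'; apply: nb.
have [p [q [oab os]]] := exit_triangle D0 (AP a' Aa) nb.
have fin c d : e c d -> c = v \/ c = u1 \/ c = u2 -> d = v \/ d = u1 \/ d = u2 ->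
    on_seg X Y c d p q -> False.
  move=> ecd hc hd ocd.
  have na w : w = a' \/ w = b' -> ~ (w = v \/ w = u1 \/ w = u2).
    by case=> ->; case=> [h|[h|h]].
  case: (planar_cross pl eab ecd oab ocd) => [[E1 E2]|[E1 E2]|[w [w1 w2 _ _]]].
  - by apply: (na a'); [left|rewrite E1].
  - by apply: (na a'); [left|rewrite E1].
  - by apply: (na w w1); case: w2 => ->.
case: os => [os|os|os].
- by apply: (fin v u1) => //; [left|right; left].
- by apply: (fin u1 u2) => //; [right; left|right; right].
- by apply: (fin u2 v) => //; [right; right|left].
Qed.

Lemma linked_hull_triangle (R : realFieldType) (V : finType) (e : rel V)
    (X Y : V -> R) :
  symmetric e -> irreflexive e -> planar e X Y ->
  joined e -> two_joined e -> link_connected e -> (2 < #|V|)%N ->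
  exists a b c, hull_triangle e X Y a b c.
Proof.
move=> esym eirr pl jn tj lk V2.
have [v [a [b [c [d [k [l [D0 Xv Yv _ Xpos]]]]]]]] := rotate_extreme pl (ltnW V2).
have [u [w H]] := linked_hull_triangle_origin esym eirr
  (planar_affine k l (lt0r_neq0 D0) pl) jn tj lk Xv Yv Xpos V2.
by exists v, u, w; apply: hull_triangle_affine H.
Qed.

(** * From plane drawings and arcs to coordinates *)

Lemma segment_coord (R : realType) (T : finType) (pi : T -> plane R) (u v : T)
    (p : plane R) :
  segment (pi u) (pi v) p <-> on_seg (fun x => (pi x).1 : R) (fun x => (pi x).2 : R) u v p.1 p.2.
Proof.
split=> [[t t01 ->]|[t t01 [E1 E2]]]; exists t => //.
by case: p E1 E2 => p q /= -> ->.
Qed.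

Lemma plane_drawing_planar (R : realType) (T : finType) (e : rel T) (pi : T -> plane R) :
  plane_drawing e pi -> planar e (fun x => (pi x).1 : R) (fun x => (pi x).2 : R).
Proof.
move=> [inj ver cro]; split.
- move=> u v E1 E2; apply: inj.
  by case: (pi u) (pi v) E1 E2 => [? ?] [? ?] /= -> ->.
- move=> u v w euv o; have := ver u v w euv; rewrite !inE => H.
  have /H /orP[/eqP ->|/eqP ->] : segment (pi u) (pi v) (pi w) by apply/segment_coord.
    by left.
  by right.
- move=> u v x y p q euv exy o1 o2.
  have [E|N] := eqVneq [set u; v]%SET [set x; y]%SET; last first.
    have /(_ (p, q)) [||w] := cro u v x y euv exy N.
    + exact/segment_coord.
    + exact/segment_coord.
    + rewrite !inE => /andP[w1 w2] Ew; apply: Or33; exists w; split.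
      * by case/orP: w1 => /eqP; [left|right].
      * by case/orP: w2 => /eqP; [left|right].
      * by rewrite -Ew.
      * by rewrite -Ew.
  have : u \in [set x; y]%SET by rewrite -E !inE eqxx.
  have : v \in [set x; y]%SET by rewrite -E !inE eqxx orbT.
  have : x \in [set u; v]%SET by rewrite E !inE eqxx.
  have : y \in [set u; v]%SET by rewrite E !inE eqxx orbT.
  rewrite !inE => h1 h2 h3 /orP[/eqP ux|/eqP uy].
    apply: Or31; split=> //; case/orP: h1 => /eqP // yu.
    by case/orP: h3 => /eqP // ->; rewrite yu.
  apply: Or32; split=> //; case/orP: h2 => /eqP // xu.
  by case/orP: h3 => /eqP // ->; rewrite xu.
Qed.

Lemma figure_blocked (R : realType) (T : finType) (e : rel T) (pi : T -> plane R)
    (p : plane R) :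
  figure e pi p <-> blocked e (fun x => (pi x).1 : R) (fun x => (pi x).2 : R) p.1 p.2.
Proof.
split=> [[[v ->]|[u [v [euv s]]]]|[[v [E1 E2]]|[u [v [euv s]]]]].
- by left; exists v.
- by right; exists u, v; split=> //; apply/segment_coord.
- by left; exists v; case: p (pi v) E1 E2 => [? ?] [? ?] /= -> ->.
- by right; exists u, v; split=> //; apply/segment_coord.
Qed.

Lemma maximal_plane_saturated (R : realType) (T : finType) (e : rel T)
    (pi : T -> plane R) :
  maximal_plane e pi -> saturated e (fun x => (pi x).1 : R) (fun x => (pi x).2 : R).
Proof.
move=> [[inj _ _] mx] u v uv nuv; apply: contrapT => h.
apply: (mx u v _ nuv); first exact/eqP.
exists (fun t : R => (1 - t) *: pi u + t *: pi v); last first.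
  by move=> t t01 /figure_blocked bl; apply: h; exists t.
split.
- apply: continuous_subspaceT => t.
  by apply: cvgD; apply: cvgZr_tmp => //; apply: cvgB => //; apply: cvg_cst.
- move=> s t _ _ E; apply: contrapT => st; apply: uv; apply: inj.
  have E1 : (1 - s) * (pi u).1 + s * (pi v).1 = (1 - t) * (pi u).1 + t * (pi v).1 :> R.
    exact: (congr1 fst E).
  have E2 : (1 - s) * (pi u).2 + s * (pi v).2 = (1 - t) * (pi u).2 + t * (pi v).2 :> R.
    exact: (congr1 snd E).
  have st0 : s - t != 0 by rewrite subr_eq0; apply/eqP.
  have F1 : (pi u).1 = (pi v).1 :> R by apply: (mulfI st0); clear -E1; lra.
  have F2 : (pi u).2 = (pi v).2 :> R by apply: (mulfI st0); clear -E2; lra.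
  by case: (pi u) (pi v) F1 F2 => [? ?] [? ?] /= -> ->.
- by rewrite subr0 scale1r scale0r addr0.
- by rewrite subrr scale0r scale1r add0r.
Qed.

(** The figure lies in the convex hull of the vertices, whose face in the direction [(f, g)] is the
    single point [u]. *)
Lemma blocked_below (R : realFieldType) (V : finType) (e : rel V) (X Y : V -> R)
    (u : V) (f g p q : R) :
  (forall x, x <> u -> f * X x + g * Y x < f * X u + g * Y u) -> blocked e X Y p q ->
  f * X u + g * Y u <= f * p + g * q -> p = X u /\ q = Y u.
Proof.
move=> se; have le x : f * X x + g * Y x <= f * X u + g * Y u.
  by have [->//|/eqP/se/ltW] := eqVneq x u.
move=> [[w [-> ->]]|[x [y [_ [t t01 [-> ->]]]]]] h.
  have [->//|/eqP/se lt] := eqVneq w u.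
  by clear -h lt; lra.
have {}h : f * X u + g * Y u <=
    (1 - t) * (f * X x + g * Y x) + t * (f * X y + g * Y y) by clear -h; lra.
have [Ex|/eqP/se ltx] := eqVneq x u; have [Ey|/eqP/se lty] := eqVneq y u.
- by subst x y; split; ring.
- subst x; have t0 : t = 0.
    by move: (f * X u + _) (f * X y + _) h lty => hu hy h lty; clear -h lty t01; nra.
  by rewrite t0; split; ring.
- subst y; have t1 : t = 1.
    by move: (f * X u + _) (f * X x + _) h ltx => hu hx h ltx; clear -h ltx t01; nra.
  by rewrite t1; split; ring.
- move: (f * X u + _) (f * X x + _) (f * X y + _) h ltx lty => hu hx hy h ltx lty.
  by have [l|l] := lerP hx hy; clear -h ltx lty t01 l; nra.
Qed.

(** The two supporting lines have to meet; if they are parallel, the first direction is tilted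
    slightly. *)
Lemma independent_extreme (R : realFieldType) (V : finType) (X Y : V -> R) (u v : V) :
  u <> v -> strictly_extreme X Y u -> strictly_extreme X Y v ->
  exists f g f' g', [/\ f * g' - g * f' != 0,
    forall x, x <> u -> f * X x + g * Y x < f * X u + g * Y u &
    forall x, x <> v -> f' * X x + g' * Y x < f' * X v + g' * Y v].
Proof.
move=> uv [f [g su]] [f' [g' sv]].
have [E|D] := eqVneq (f * g' - g * f') 0; last by exists f, g, f', g'.
have [|eps eps0 H] := @small_perturbation R V (fun x => x <> u)
    (fun x => f * X u + g * Y u - (f * X x + g * Y x))
    (fun x => - g * X u + f * Y u - (- g * X x + f * Y x)).
  by move=> x /su; left; lra.
exists (f + eps * - g), (g + eps * f), f', g'; split=> //; last first.
  by move=> x /H; lra.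
have -> : (f + eps * - g) * g' - (g + eps * f) * f' =
    (f * g' - g * f') - eps * (f * f' + g * g') by ring.
rewrite E sub0r oppr_eq0 mulf_neq0 //; first exact: lt0r_neq0.
apply/eqP => E'.
have vu : v <> u by move=> E2; apply: uv.
have nz : f * f + g * g != 0.
  apply/eqP => /sum_squares0 [f0 g0].
  by have := su v vu; rewrite f0 g0; clear; lra.
have f'0 : f' = 0.
  apply: (mulfI nz); transitivity (f * (f * f' + g * g') - g * (f * g' - g * f')); first by ring.
  by rewrite E E'; ring.
have g'0 : g' = 0.
  apply: (mulfI nz); transitivity (g * (f * f' + g * g') + f * (f * g' - g * f')); first by ring.
  by rewrite E E'; ring.
by have := sv u uv; rewrite f'0 g'0; clear; lra.
Qed.

(* The arc goes from [u] to [v] through the common point [c] of supporting lines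
   at [u] and [v], hence stays outside the convex hull of the drawing. *)
Lemma maximal_plane_extreme_adjacent (R : realType) (T : finType) (e : rel T)
    (pi : T -> plane R) :
  maximal_plane e pi -> extreme_adjacent e (fun x => (pi x).1 : R) (fun x => (pi x).2 : R).
Proof.
move=> [[inj _ _] mx] u v uv seu sev; apply: contrapT => /negP nuv.
have [f [g [f' [g' [D su sv]]]]] := independent_extreme uv seu sev.
set X := (fun x => (pi x).1 : R) in su sv; set Y := (fun x => (pi x).2 : R) in su sv.
pose al : R := f * X u + g * Y u; pose be : R := f' * X v + g' * Y v.
have [c1 [c2 [C1 C2]]] := ex_preimage_affine 0 0 al be D.
rewrite !addr0 in C1 C2.
have vu : v <> u by move=> E; apply: uv.
pose c : plane R := (c1, c2).
(* [lo t] is the minimum of [2 t] and 1, and [hi t] the maximum of [2 t - 1] and 0, written so that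
   continuity is evident; the arc passes through [c] at [t = 1 / 2]. *)
pose lo (t : R) : R := (2 * t + 1 - `|2 * t - 1|) / 2.
pose hi (t : R) : R := (2 * t - 1 + `|2 * t - 1|) / 2.
have lohi1 t : 2 * t <= 1 -> lo t = 2 * t /\ hi t = 0.
  by move=> h; rewrite /lo /hi ler0_norm ?subr_le0 //; split; lra.
have lohi2 t : 1 <= 2 * t -> lo t = 1 /\ hi t = 2 * t - 1.
  by move=> h; rewrite /lo /hi ger0_norm ?subr_ge0 //; split; lra.
pose G t := pi u + lo t *: (c - pi u) + hi t *: (pi v - c).
have G1 t : (G t).1 = X u + lo t * (c1 - X u) + hi t * (X v - c1) :> R by [].
have G2 t : (G t).2 = Y u + lo t * (c2 - Y u) + hi t * (Y v - c2) :> R by [].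
have fu : f' * X u + g' * Y u < be by apply: sv.
have fv : f * X v + g * Y v < al by apply: su.
have H1 (t : R) : 2 * t <= 1 -> f * (G t).1 + g * (G t).2 = al :> R.
  move=> /lohi1 [l h]; rewrite G1 G2 l h.
  have -> : f * (X u + 2 * t * (c1 - X u) + 0 * (X v - c1)) +
     g * (Y u + 2 * t * (c2 - Y u) + 0 * (Y v - c2)) =
     al + 2 * t * (f * c1 + g * c2 - al) by rewrite /al; ring.
  by rewrite -C1; ring.
have H2 (t : R) : 1 <= 2 * t -> f' * (G t).1 + g' * (G t).2 = be :> R.
  move=> /lohi2 [l h]; rewrite G1 G2 l h.
  have -> : f' * (X u + 1 * (c1 - X u) + (2 * t - 1) * (X v - c1)) +
     g' * (Y u + 1 * (c2 - Y u) + (2 * t - 1) * (Y v - c2)) =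
     (f' * c1 + g' * c2) + (2 * t - 1) * (be - (f' * c1 + g' * c2)) by rewrite /be; ring.
  by rewrite -C2; ring.
have H1' (t : R) : 2 * t <= 1 -> f' * (G t).1 + g' * (G t).2 =
    f' * X u + g' * Y u + 2 * t * (be - (f' * X u + g' * Y u)) :> R.
  by move=> /lohi1 [l h]; rewrite G1 G2 l h C2; ring.
have H2' (t : R) : 1 <= 2 * t -> f * (G t).1 + g * (G t).2 =
    al + (2 * t - 1) * (f * X v + g * Y v - al) :> R.
  by move=> /lohi2 [l h]; rewrite G1 G2 l h C1; ring.
apply: (mx u v _ nuv); first exact/eqP.
exists G; last first.
  move=> t t01 /figure_blocked bl.
  have [t2|t2] := lerP (2 * t) 1.
    have [|E1 E2] := blocked_below su bl; first by rewrite H1.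
    have := H1' t t2; rewrite E1 E2; clear -fu t01; nra.
  have [|E1 E2] := blocked_below sv bl; first by rewrite H2 // ltW.
  by have := H2' t (ltW t2); rewrite E1 E2; clear -fv t01 t2; nra.
split.
- apply: continuous_subspaceT => t.
  have c2t : ((fun t : R => 2 * t) @ t --> 2 * t)%classic.
    by apply: cvgM; [exact: cvg_cst|exact: cvg_id].
  have cn : ((fun t : R => `|2 * t - 1|) @ t --> `|2 * t - 1|)%classic.
    by apply: cvg_norm; apply: cvgB => //; exact: cvg_cst.
  have clo : (lo @ t --> lo t)%classic.
    apply: cvgM; last exact: cvg_cst.
    by apply: cvgB => //; apply: cvgD => //; exact: cvg_cst.
  have chi : (hi @ t --> hi t)%classic.
    apply: cvgM; last exact: cvg_cst.
    by apply: cvgD => //; apply: cvgB => //; exact: cvg_cst.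
  apply: cvgD; first apply: cvgD; first exact: cvg_cst.
    exact: cvgZr_tmp.
  exact: cvgZr_tmp.
- move=> s t _ _ E.
  have E1 : (G s).1 = (G t).1 :> R by rewrite E.
  have E2 : (G s).2 = (G t).2 :> R by rewrite E.
  have [s2|s2] := lerP (2 * s) 1; have [t2|t2] := lerP (2 * t) 1.
  + have := H1' s s2; rewrite E1 E2 H1' // => h.
    have n0 : be - (f' * X u + g' * Y u) != 0 by clear -fu; lra.
    by apply: (mulIf n0); clear -h; lra.
  + have := H1' s s2; rewrite E1 E2 H2 ?ltW // => h.
    have := H2' t (ltW t2); rewrite -E1 -E2 H1 // => h'.
    by clear -h h' fu fv s2 t2; nra.
  + have := H1' t t2; rewrite -E1 -E2 H2 ?ltW // => h.
    have := H2' s (ltW s2); rewrite E1 E2 H1 // => h'.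
    by clear -h h' fu fv s2 t2; nra.
  + have := H2' s (ltW s2); rewrite E1 E2 H2' ?ltW // => h.
    have n0 : f * X v + g * Y v - al != 0 by clear -fv; lra.
    by apply: (mulIf n0); clear -h; lra.
- have [l h] : lo 0 = 2 * 0 /\ hi 0 = 0 by apply: lohi1; lra.
  by rewrite /G l h mulr0 !scale0r !addr0.
- have [l h] : lo 1 = 1 /\ hi 1 = 2 * 1 - 1 by apply: lohi2; lra.
  rewrite /G l h mulr1 (_ : 2 - 1 = 1); last by lra.
  by rewrite !scale1r [pi u + _]addrC subrK addrC subrK.
Qed.

(** * Counting the half-plane cuts of a point set *)

Definition shattered (T : finType) (F : {set {set T}}) : {set {set T}} :=
  [set S : {set T} | [forall (U : {set T} | U \subset S),
     [exists A in F, A :&: S == U]]]%SET.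

Lemma shatteredP (T : finType) (F : {set {set T}}) (S : {set T}) :
  reflect (forall U : {set T}, U \subset S -> exists2 A, A \in F & A :&: S = U)
    (S \in shattered F).
Proof.
rewrite inE; apply: (iffP forall_inP) => h U /h.
  by case/exists_inP => A AF /eqP; exists A.
by move=> [A AF E]; apply/exists_inP; exists A => //; apply/eqP.
Qed.

(* Pajor's form of the Sauer-Shelah lemma. *)
Lemma card_shattered (T : finType) (F : {set {set T}}) : (#|F| <= #|shattered F|)%N.
Proof.
have [n] := ubnP #|F|; elim: n F => // n IH F; rewrite ltnS => Fn.
have [->|[A AF]] := set_0Vmem F; first by rewrite cards0.
have [F1|F2] := leqP #|F| 1.
  apply: (leq_trans F1); rewrite card_gt0; apply/set0Pn; exists finset.set0.
  apply/shatteredP => U; rewrite finset.subset0 => /eqP ->.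
  by exists A => //; rewrite finset.setI0.
have [x [B [C [BF CF xB xC]]]] : exists x B C, [/\ B \in F, C \in F, x \in B & x \notin C].
  case/card_gt1P: F2 => B [C [BF CF BC]].
  have [BsC|/subsetPn[x xB xC]] := boolP (B \subset C); last by exists x, B, C.
  have [CsB|/subsetPn[x xC xB]] := boolP (C \subset B); last by exists x, C, B.
  by rewrite finset.eqEsubset BsC CsB in BC.
pose G := [set D : {set T} | x \in D]%SET.
have IG : (#|F :&: G| <= #|shattered (F :&: G)|)%N.
  apply: IH; apply: leq_trans Fn; apply: proper_card; apply/properP; split.
    exact: finset.subsetIl.
  by exists C => //; rewrite !inE CF.
have ID : (#|F :\: G| <= #|shattered (F :\: G)|)%N.
  apply: IH; apply: leq_trans Fn; apply: proper_card; apply/properP; split.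
    exact: finset.subsetDl.
  by exists B => //; rewrite !inE xB BF.
rewrite -(cardsID G F); apply: (leq_trans (leq_add IG ID)).
set S1 := shattered (F :&: G); set S0 := shattered (F :\: G).
have xS1 S : S \in S1 -> x \notin S.
  move=> /shatteredP/(_ finset.set0 (finset.sub0set _)) [D]; rewrite !inE => /andP[_ xD] E.
  by apply/negP => xS; have := finset.in_set0 x; rewrite -E inE xD xS.
have xS0 S : S \in S0 -> x \notin S.
  move=> /shatteredP/(_ S (subxx _)) [D]; rewrite !inE => /andP[xD _] E.
  by apply/negP; rewrite -E inE (negbTE xD).
(* A set [S] shattered by both halves is counted twice; the second count is charged to [x |: S],
   which the whole family shatters as well. *)
rewrite -cardsUI -(@card_in_imset _ _ (fun S => x |: S) (S1 :&: S0)); last first.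
  move=> S S'; rewrite !finset.in_setI => /andP[/xS1 xS _] /andP[/xS1 xS' _] E.
  by rewrite -(finset.setU1K xS) E finset.setU1K.
have dis : [disjoint S1 :|: S0 & [set x |: S | S in S1 :&: S0]%SET].
  rewrite disjoint_subset; apply/fintype.subsetP => S; rewrite finset.in_setU => S10.
  rewrite inE; apply/negP => /imsetP[S' _ E].
  have : x \in S by rewrite E !inE eqxx.
  by apply/negP; case/orP: S10 => [/xS1|/xS0].
move: dis; rewrite -leq_card_setU => /eqP <-; apply: subset_leq_card.
apply/fintype.subsetP => S; rewrite !finset.in_setU => /orP[/orP[]|].
- move=> /shatteredP h; apply/shatteredP => U /h [D].
  by rewrite !inE => /andP[DF _] E; exists D.
- move=> /shatteredP h; apply/shatteredP => U /h [D].
  by rewrite !inE => /andP[_ DF] E; exists D.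
- move=> /imsetP[S']; rewrite finset.in_setI => /andP[S'1 S'0] ->; apply/shatteredP => U US.
  have nx : x \notin S' by exact: xS1.
  have US' : U :\ x \subset S'.
    apply/fintype.subsetP => y; rewrite !inE => /andP[yx /(fintype.subsetP US)].
    by rewrite !inE (negbTE yx).
  have [xU|xU] := boolP (x \in U).
    move/shatteredP/(_ _ US') : S'1 => [D]; rewrite !inE => /andP[DF xD] E.
    exists D => //; apply/finset.setP => y; rewrite !inE.
    have := congr1 (fun Z : {set T} => y \in Z) E; rewrite !inE.
    by have [->|_] := eqVneq y x; rewrite ?xD ?xU.
  move/shatteredP/(_ _ US') : S'0 => [D]; rewrite !inE => /andP[xD DF] E.
  exists D => //; apply/finset.setP => y; rewrite !inE.
  have := congr1 (fun Z : {set T} => y \in Z) E; rewrite !inE.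
  by have [->|_] := eqVneq y x; rewrite ?(negbTE xD) ?(negbTE xU).
Qed.

Definition halfplane_cuts (R : realType) (T : finType) (X Y : T -> R) : {set {set T}} :=
  [set A : {set T} | `[< exists f g h : R, A = [set t | (0 <= f * X t + g * Y t + h)%R]%SET >]]%SET.

(* Four or more points are affinely dependent, and a half-plane cannot separate
   the positive from the negative part of an affine dependence (Radon). *)
Lemma shattered_halfplane_cuts (R : realType) (T : finType) (X Y : T -> R) (S : {set T}) :
  S \in shattered (halfplane_cuts X Y) -> (#|S| <= 3)%N.
Proof.
move=> /shatteredP sh; rewrite leqNgt; apply/negP => S4.
(* The third column is constant 1, so a row in the left kernel of [M] is an affine dependence of the
   points. *)
pose M : 'M[R]_(#|S|, 3) := \matrix_(i, j)
  (if j == 0 then X (enum_val i) else if j == 1 then Y (enum_val i) else 1).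
have : kermx M != 0.
  rewrite kermx_eq0 /row_free; apply/eqP => rk.
  by have := rank_leq_col M; rewrite rk leqNgt S4.
case/rowV0Pn => la /sub_kermxP laM la0.
have lin (f g h : R) : \sum_i la 0 i * (f * X (enum_val i) + g * Y (enum_val i) + h) = 0.
  have col (j : 'I_3) : \sum_i la 0 i * M i j = 0.
    by have := congr1 (fun Z : 'rV_3 => Z 0 j) laM; rewrite !mxE.
  transitivity (f * (\sum_i la 0 i * M i 0) + g * (\sum_i la 0 i * M i 1) +
     h * (\sum_i la 0 i * M i (inord 2))); last by rewrite !col !mulr0 !addr0.
  rewrite !mulr_sumr -!big_split /=; apply: eq_bigr => i _; rewrite !mxE /=.
  have -> : (inord 2 == 0 :> 'I_3) = false by apply/eqP => /(congr1 val); rewrite /= inordK.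
  have -> : (inord 2 == 1 :> 'I_3) = false by apply/eqP => /(congr1 val); rewrite /= inordK.
  by ring.
(* A cut with trace [U] makes every [la i * s i] nonnegative, while they add up to 0, so all of them
   vanish. Then no coefficient is negative, and since the coefficients also add up to 0, all are
   0. *)
pose U := [set t in S | [exists i, (enum_val i == t) && (0 < la 0 i)]]%SET.
have [|A] := sh U; first by apply/fintype.subsetP => t; rewrite inE => /andP[].
rewrite inE => /asboolP[f [g [h AE]]] AS.
pose s (i : 'I_#|S|) := f * X (enum_val i) + g * Y (enum_val i) + h.
have inU (i : 'I_#|S|) : (enum_val i \in U) = (0 < la 0 i).
  rewrite inE enum_valP /=; apply/existsP/idP => [[j /andP[/eqP/enum_val_inj -> //]]|li].
  by exists i; rewrite eqxx.
have inA (i : 'I_#|S|) : (0 <= s i) = (0 < la 0 i).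
  by rewrite -inU -AS inE enum_valP andbT AE inE.
have ge0 i : 0 <= la 0 i * s i.
  have := inA i; have [li h'|li /negbT] := ltrP 0 (la 0 i).
    by rewrite mulr_ge0 // ?h' // ltW.
  by rewrite -ltNge => /ltW s0; rewrite mulr_le0.
have eq0 i : la 0 i * s i = 0.
  apply/eqP; have /eqP := lin f g h; rewrite psumr_eq0 //.
  by move/allP/(_ i (mem_index_enum i)).
have la_ge0 i : 0 <= la 0 i.
  have := inA i; have [/ltW //|li /negbT] := ltrP 0 (la 0 i).
  rewrite -ltNge => s0; move/eqP: (eq0 i); rewrite mulf_eq0 (lt_eqF s0) orbF.
  by move/eqP ->.
case/negP: la0; apply/eqP/matrixP => i j; rewrite ord1 mxE; apply/eqP.
have /eqP := lin 0 0 1; rewrite psumr_eq0; last first.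
  by move=> k _; rewrite !mul0r !add0r mulr1.
by move/allP/(_ j (mem_index_enum j)); rewrite !mul0r !add0r mulr1.
Qed.

Lemma card_sets_le3 (T : finType) :
  (#|[set S : {set T} | (#|S| <= 3)%N]%SET| <= (#|T|.+1) ^ 3)%N.
Proof.
rewrite -card_option -[X in (_ ^ X)%N](card_ord 3) -card_ffun.
(* A set of at most three elements is the set of values of such a map, with [None] as padding. *)
pose phi (g : {ffun 'I_3 -> option T}) := [set x | [exists i, g i == Some x]]%SET.
apply: (leq_trans _ (leq_imset_card phi predT)); apply: subset_leq_card.
apply/fintype.subsetP => S; rewrite inE => S3; apply/imsetP.
exists [ffun i : 'I_3 => nth None (map Some (enum S)) i] => //.
apply/finset.setP => x; rewrite inE; apply/idP/existsP => [xS|[i]].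
  have xe : x \in enum S by rewrite mem_enum.
  have lt : (index x (enum S) < 3)%N.
    by apply: leq_trans S3; rewrite cardE index_mem.
  exists (Ordinal lt); rewrite ffunE /= (nth_map x) ?index_mem //.
  by rewrite nth_index.
rewrite ffunE => /eqP E; rewrite -mem_enum.
have [lt|ge] := ltnP i (size (enum S)); last by rewrite nth_default ?size_map in E.
by move: E; rewrite (nth_map x) // => -[<-]; exact: mem_nth.
Qed.

Lemma card_halfplane_cuts (R : realType) (T : finType) (X Y : T -> R) :
  (#|halfplane_cuts X Y| <= (#|T|.+1) ^ 3)%N.
Proof.
apply: (leq_trans (card_shattered _)); apply: (leq_trans _ (card_sets_le3 T)).
apply: subset_leq_card; apply/fintype.subsetP => S /shattered_halfplane_cuts.
by rewrite inE.
Qed.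

(** * Counting permutations *)

Lemma card_perm_restricted (T : finType) (x0 : T) (F : {set T}) (B : T -> {set T}) (k : nat) :
  (forall x, x \in F -> #|B x| <= k)%N ->
  (#|[set s : {perm T} | [forall x in F, s x \in B x]]%SET|
     <= k ^ #|F| * (#|T| - #|F|)`!)%N.
Proof.
move=> Bk; pose P := [set s : {perm T} | [forall x in F, s x \in B x]]%SET.
pose r (s : {perm T}) : {ffun T -> T} := [ffun x => if x \in F then s x else x0].
rewrite -/P -sum1_card (partition_big r (mem (pfamily x0 (mem F) (fun x => mem (B x))))) /=;
  last first.
  move=> s; rewrite inE => /forall_inP sB; apply/pfamilyP; split.
    by apply/fintype.subsetP => x; rewrite inE ffunE; case: ifP; rewrite ?eqxx.
  by move=> x xF; rewrite ffunE xF; exact: sB.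
have fiber g : (\sum_(s in P | r s == g) 1 <= (#|T| - #|F|)`!)%N.
  rewrite sum1dep_card; set Q := finset _.
  have [->|[s0]] := set_0Vmem Q; first by rewrite cards0.
  rewrite inE => /andP[_ /eqP rs0].
  have <- : #|~: F| = (#|T| - #|F|)%N by rewrite cardsCs finset.setCK.
  (* Permutations that agree with [s0] on [F] become, after multiplication by the inverse of [s0],
     permutations that fix [F] pointwise. *)
  rewrite -(card_imset (mem Q) (mulIg (s0^-1)%g)) -card_perm; apply: subset_leq_card; apply/fintype.subsetP => _ /imsetP[s sQ ->].
  move: sQ; rewrite inE => /andP[_ /eqP rs]; apply/fintype.subsetP => x.
  rewrite !inE permM; apply: contraNN => xF.
  have := congr1 (fun f : {ffun T -> T} => f x) rs; rewrite -rs0 !ffunE xF => ->.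
  by rewrite permK.
apply: (@leq_trans (\sum_(g in pfamily x0 (mem F) (fun x => mem (B x)))
    (#|T| - #|F|)`!)%N); first by apply: leq_sum => g _; exact: fiber.
rewrite sum_nat_const leq_mul2r; apply/orP; right.
rewrite card_pfamily foldrE big_map big_enum /= -prod_nat_const.
by apply: leq_prod => x xF; exact: Bk.
Qed.

Lemma card_bigcup_leq (I T : finType) (P : pred I) (W : I -> {set T}) :
  (#|\bigcup_(i | P i) W i| <= \sum_(i | P i) #|W i|)%N.
Proof.
apply: (big_ind2 (fun (A : {set T}) n => #|A| <= n)%N); first by rewrite cards0.
  by move=> A a B b Aa Bb; apply: (leq_trans (leq_card_setU A B)); exact: leq_add.
by [].
Qed.

(* Union bound over the table [d] and the set of [m] hits. *)
Lemma ex_perm_few_hits (T : finType) (x0 : T) (k m : nat) (blk : T -> 'I_k)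
    (D : {set {ffun T -> option 'I_k}}) :
  (forall i, #|[set v | blk v == i]%SET| <= k)%N ->
  (#|D| * 2 ^ #|T| * (k ^ m * (#|T| - m)`!) < (#|T|)`!)%N ->
  exists s : {perm T}, forall d, d \in D ->
    (#|[set x | d x == Some (blk (s x))]%SET| < m)%N.
Proof.
move=> bk lt; apply: contrapT => h.
pose W (p : {ffun T -> option 'I_k} * {set T}) : {set {perm T}} :=
  [set s : {perm T} | [forall x in p.2, s x \in [set v | p.1 x == Some (blk v)]%SET]]%SET.
pose Q := [pred p : {ffun T -> option 'I_k} * {set T} | (p.1 \in D) && (#|p.2| == m)].
have cov : [set: {perm T}]%SET \subset \bigcup_(p | Q p) W p.
  apply/fintype.subsetP => s _; apply: contrapT => ns; apply: h; exists s => d dD.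
  rewrite ltnNge; apply/negP => hm; apply: ns.
  case/card_geqP: hm => l [lu lm ls].
  apply/bigcupP; exists (d, [set x in l]%SET).
    by rewrite /= dD cardsE; apply/eqP; rewrite -lm; apply/card_uniqP.
  rewrite inE; apply/forall_inP => x /=; rewrite !inE => /ls.
  by rewrite inE.
have cardT : #|[set: {perm T}]%SET| = (#|T|)`!.
  rewrite -(finset.cardsT T) -card_perm; apply: eq_card => s; rewrite !inE.
  by apply/esym/fintype.subsetP => x; rewrite inE.
move: lt; apply/negP; rewrite -leqNgt -cardT.
apply: (leq_trans (subset_leq_card cov)); apply: (leq_trans (card_bigcup_leq _ _)).
apply: (@leq_trans (\sum_(p | Q p) (k ^ m * (#|T| - m)`!))%N).
  apply: leq_sum => -[d F] /andP[/= dD /eqP Fm]; rewrite -Fm.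
  apply: card_perm_restricted => // x _.
  case: (d x) => [i|]; last by rewrite (eq_card0 (A := _)) // => v; rewrite inE.
  apply: leq_trans (bk i); apply: subset_leq_card; apply/fintype.subsetP => v.
  by rewrite !inE => /eqP[->].
rewrite sum_nat_const leq_mul2r; apply/orP; right.
rewrite -(finset.cardsT T) -card_powerset -cardsX; apply: subset_leq_card.
by apply/fintype.subsetP => -[d F] /andP[/= dD _]; rewrite !inE dD finset.subsetT.
Qed.

(** * Nested block triangles and the decoding of points *)

Definition in_triangle (R : realFieldType) (V : finType) (X Y : V -> R) (a b c : V)
    (p q : R) : Prop :=
  [/\ 0 <= side X Y a b p q, 0 <= side X Y b c p q & 0 <= side X Y c a p q].

Record block_triangle (R : realFieldType) (V I : finType) (e : rel V) (X Y : V -> R)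
    (blk : V -> I) (i : I) (a b c : V) : Prop := BlockTriangle {
  block_triangle_blk : [/\ blk a = i, blk b = i & blk c = i];
  block_triangle_edges : [/\ e a b, e b c & e c a];
  block_triangle_area : 0 < area X Y a b c;
  block_triangle_in : forall v, blk v = i -> in_triangle X Y a b c (X v) (Y v) }.

(** Compares the largest abscissas of the two blocks. This is asymmetric and increases along nested
    triangles, which suffices to single out the innermost one. *)
Definition left_of_block (R : realFieldType) (V I : finType) (X : V -> R)
    (blk : V -> I) (i j : I) : Prop :=
  exists2 z, blk z = j & forall y, blk y = i -> X y < X z.

Lemma left_of_block_asym (R : realFieldType) (V I : finType) (X : V -> R)
    (blk : V -> I) (i j : I) :
  left_of_block X blk i j -> left_of_block X blk j i -> False.
Proof.
move=> [z zj zi] [z' z'i z'j]; have := zi _ z'i; have := z'j _ zj.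
by move=> h /(lt_trans h); rewrite ltxx.
Qed.

(* An edge of block [i] cannot cross the boundary of the triangle of block [j],
   so a block with one vertex in that triangle lies in its interior. *)
Lemma nested_left_of (R : realFieldType) (V I : finType) (e : rel V) (X Y : V -> R)
    (blk : V -> I) (i j : I) (a b c x : V) :
  planar e X Y -> i <> j -> block_triangle e X Y blk j a b c ->
  (forall (A : pred V) u v, blk u = i -> blk v = i -> A u -> ~~ A v ->
    exists u' v', [/\ blk u' = i, blk v' = i, A u', ~~ A v' & e u' v']) ->
  blk x = i -> in_triangle X Y a b c (X x) (Y x) -> left_of_block X blk i j.
Proof.
move=> pl ij [[ba bb bc] [eab ebc eca] D0 _] jn xi xin.
have nocross u v c1 c2 p q : blk u = i -> blk v = i -> blk c1 = j -> blk c2 = j ->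
    e u v -> e c1 c2 -> on_seg X Y u v p q -> on_seg X Y c1 c2 p q -> False.
  move=> ui vi c1j c2j euv ecc o1 o2.
  case: (planar_cross pl euv ecc o1 o2) => [[E _]|[E _]|[w [w1 w2 _ _]]].
  - by apply: ij; rewrite -ui E.
  - by apply: ij; rewrite -ui E.
  - have wi : blk w = i by case: w1 => ->.
    by apply: ij; rewrite -wi; case: w2 => ->.
have alln y : blk y = i -> in_triangle X Y a b c (X y) (Y y).
  move=> yi; apply: contrapT => ny.
  pose A : pred V := fun z => `[< in_triangle X Y a b c (X z) (Y z) >].
  have Ax : A x by apply/asboolP.
  have Ay : ~~ A y by apply/asboolP.
  have [u [v [ui vi /asboolP Au /asboolP Av euv]]] := jn A x y xi yi Ax Ay.
  have [p [q [ouv os]]] := exit_triangle D0 Au Av.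
  case: os => os; first exact: (nocross u v a b p q).
    exact: (nocross u v b c p q).
  exact: (nocross u v c a p q).
have [|y yi ymax] := @ex_argmin R V (fun y => blk y = i) (fun y => - X y); first by exists x.
have [h1 h2 h3] := alln y yi.
have noton c1 c2 : blk c1 = j -> blk c2 = j -> e c1 c2 ->
    on_seg X Y c1 c2 (X y) (Y y) -> False.
  move=> c1j c2j ecc oy; apply: ij; rewrite -yi.
  by case: (planar_vertex pl ecc oy) => ->.
have p1 : 0 < side X Y a b (X y) (Y y).
  rewrite lt_neqAle h1 andbT; apply/eqP => E.
  by apply: (noton a b) => //; apply: (on_side D0).
have p2 : 0 < side X Y b c (X y) (Y y).
  rewrite lt_neqAle h2 andbT; apply/eqP => E; apply: (noton b c) => //.
  by apply: (on_side (c := a)) => //; rewrite area_rot.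
have p3 : 0 < side X Y c a (X y) (Y y).
  rewrite lt_neqAle h3 andbT; apply/eqP => E; apply: (noton c a) => //.
  by apply: (on_side (c := b)) => //; rewrite -area_rot.
(* The rightmost vertex [y] of block [i] is a combination of [a], [b], [c] with positive weights, so
   one of them lies strictly to its right, unless all three share its abscissa and the triangle is
   degenerate. *)
have bary : side X Y b c (X y) (Y y) * (X y - X a) +
   side X Y c a (X y) (Y y) * (X y - X b) + side X Y a b (X y) (Y y) * (X y - X c) = 0.
  by rewrite /side; ring.
have [z zj lt] : exists2 z, blk z = j & X y < X z.
  apply: contrapT => h.
  have le z : blk z = j -> 0 <= X y - X z.
    by move=> zj; rewrite subr_ge0 leNgt; apply/negP => lt; apply: h; exists z.
  have la := le a ba; have lb := le b bb; have lc := le c bc.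
  have Ea : X a = X y by clear -la lb lc p1 p2 p3 bary; nra.
  have Eb : X b = X y by clear -la lb lc p1 p2 p3 bary; nra.
  have Ec : X c = X y by clear -la lb lc p1 p2 p3 bary; nra.
  by move: D0; rewrite /area /side Ea Eb Ec; clear; lra.
exists z => // y' /ymax le; apply: le_lt_trans lt; clear -le; lra.
Qed.

(* [H (i, l)] are the traces of three half-planes bounding the triangle of block
   [i], and [O] records a strict order for which nested triangles increase; a point
   is assigned to the least triangle containing it. *)
Definition decode (T : finType) (k : nat) (H : {ffun 'I_k * 'I_3 -> {set T}})
    (O : {set 'I_k * 'I_k}) : {ffun T -> option 'I_k} :=
  [ffun t => [pick i | [forall l, t \in H (i, l)] &&
     [forall j, (j != i) && [forall l, t \in H (j, l)] ==> ((i, j) \in O)]]].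

Definition decodings (R : realType) (T : finType) (k : nat) (X Y : T -> R) :
    {set {ffun T -> option 'I_k}} :=
  [set decode p.1 p.2 | p in
     finset.setX [set H | H \in ffun_on (mem (halfplane_cuts X Y))]%SET
            [set: {set 'I_k * 'I_k}]%SET]%SET.

(** There are [3 * k] half-planes with at most [(#|T|.+1) ^ 3] traces each, whence the exponent
    [9 * k], and one bit for each pair of blocks. *)
Lemma card_decodings (R : realType) (T : finType) (k : nat) (X Y : T -> R) :
  (#|decodings k X Y| <= (#|T|.+1) ^ (9 * k) * 2 ^ (k * k))%N.
Proof.
apply: (leq_trans (leq_imset_card _ _)); rewrite cardsX; apply: leq_mul.
  rewrite cardsE card_ffun_on card_prod !card_ord.
  rewrite (_ : 9 * k = 3 * (k * 3))%N; last by rewrite [(k * 3)%N]mulnC mulnA.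
  rewrite (expnM _ 3); case: (posnP (k * 3)%N) => [->|k0]; first by rewrite !expn0.
  by rewrite leq_exp2r //; exact: card_halfplane_cuts.
rewrite -[X in (_ <= 2 ^ X)%N](_ : #|[set: 'I_k * 'I_k]%SET| = k * k)%N.
  by rewrite -card_powerset powersetT.
by rewrite finset.cardsT card_prod !card_ord.
Qed.

(** [X0], [Y0] are the given points and [X], [Y] is a competing drawing, whose triangles cut the
    given points by half-planes. The resulting table is right wherever a vertex is drawn at a given
    point, independently of any bijection. *)
Lemma decode_block (R : realType) (T : finType) (k : nat) (e : rel T) (X Y X0 Y0 : T -> R)
    (blk : T -> 'I_k) :
  planar e X Y ->
  (forall i (A : pred T) u v, blk u = i -> blk v = i -> A u -> ~~ A v ->
    exists u' v', [/\ blk u' = i, blk v' = i, A u', ~~ A v' & e u' v']) ->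
  (forall i, exists a b c, block_triangle e X Y blk i a b c) ->
  exists2 d, d \in decodings k X0 Y0 &
    forall t v, X0 t = X v -> Y0 t = Y v -> d t = Some (blk v).
Proof.
move=> pl jn /choice [a /choice [b /choice [c tri]]].
pose cut (i : 'I_k) (l : 'I_3) : {set T} := [set t | if l == 0 then
    0 <= side X Y (a i) (b i) (X0 t) (Y0 t) else if l == 1 then
    0 <= side X Y (b i) (c i) (X0 t) (Y0 t) else
    0 <= side X Y (c i) (a i) (X0 t) (Y0 t)]%SET.
pose H : {ffun 'I_k * 'I_3 -> {set T}} := [ffun p => cut p.1 p.2].
pose O : {set 'I_k * 'I_k} := [set p | `[< left_of_block X blk p.1 p.2 >]]%SET.
have HP i t : reflect (in_triangle X Y (a i) (b i) (c i) (X0 t) (Y0 t))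
    [forall l, t \in H (i, l)].
  apply: (iffP forallP) => [h|[h1 h2 h3] l]; last first.
    by rewrite ffunE inE /=; case: ifP => // _; case: ifP.
  have := h 0; have := h 1; have := h (inord 2); rewrite !ffunE !inE /=.
  have -> : (inord 2 == 0 :> 'I_3) = false by apply/eqP => /(congr1 val); rewrite /= inordK.
  have -> : (inord 2 == 1 :> 'I_3) = false by apply/eqP => /(congr1 val); rewrite /= inordK.
  by move=> h3 h2 h1; split.
exists (decode H O).
  apply/imsetP; exists (H, O) => //; rewrite !inE andbT; apply/ffun_onP => -[i l].
  have sideE u v t : side X Y u v (X0 t) (Y0 t) = - (Y v - Y u) * X0 t +
      (X v - X u) * Y0 t + ((Y v - Y u) * X u - (X v - X u) * Y u).
    by rewrite /side; ring.
  rewrite ffunE inE; apply/asboolP; rewrite /cut /=.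
  have cutE u v : exists f g h : R, [set t | 0 <= side X Y u v (X0 t) (Y0 t)]%SET =
      [set t | 0 <= f * X0 t + g * Y0 t + h]%SET.
    exists (- (Y v - Y u)), (X v - X u), ((Y v - Y u) * X u - (X v - X u) * Y u).
    by apply/finset.setP => t; rewrite !inE sideE.
  by case: (l == 0); [|case: (l == 1)]; exact: cutE.
move=> t v Xt Yt.
(* Every other triangle containing [v] belongs to a block above [blk v] in the recorded order. Hence
   [blk v] qualifies in [decode] and, by asymmetry, no other block does. *)
have good i : in_triangle X Y (a i) (b i) (c i) (X v) (Y v) -> i <> blk v ->
    left_of_block X blk (blk v) i.
  move=> vi ivb; apply: (nested_left_of pl _ (tri i) _ _ vi) => //.
  - by move=> E; apply: ivb.
  - exact: jn.
have own : in_triangle X Y (a (blk v)) (b (blk v)) (c (blk v)) (X v) (Y v).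
  exact: (block_triangle_in (tri (blk v))) erefl.
rewrite ffunE; case: pickP => [i /andP[/HP it /forallP iO]|/(_ (blk v)) /negP []].
  rewrite Xt Yt in it; have [->//|/eqP ib] := eqVneq i (blk v).
  have := iO (blk v); rewrite eq_sym; have -> /= : i != blk v by exact/eqP.
  move/implyP => h; have /h : [forall l, t \in H (blk v, l)] by apply/HP; rewrite Xt Yt.
  rewrite inE => /asboolP /=; have := good i it ib.
  by move=> h1 h2; case: (left_of_block_asym h1 h2).
apply/andP; split; first by apply/HP; rewrite Xt Yt.
apply/forallP => j; apply/implyP => /andP[/eqP jb /HP]; rewrite Xt Yt => jt.
by rewrite inE; apply/asboolP; exact: good.
Qed.

(** * Bounding [FIX] under a counting inequality *)

Lemma planar_induced (R : realFieldType) (T : finType) (e : rel T) (X Y : T -> R)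
    (B : {set T}) :
  planar e X Y -> planar (Defs.induced e B) (X \o val) (Y \o val).
Proof.
move=> pl; split.
- by move=> u v E1 E2; apply: val_inj; apply: (planar_inj pl).
- by move=> u v w euv /(planar_vertex pl euv) [/val_inj|/val_inj]; [left|right].
- move=> u v x y p q euv exy o1 o2.
  case: (planar_cross pl euv exy o1 o2) => [[/val_inj ? /val_inj ?]|[/val_inj ? /val_inj ?]|].
  + exact: Or31.
  + exact: Or32.
  move=> [w [w1 w2 E1 E2]].
  have [w' Ew] : exists w' : {x : T | x \in B}, val w' = w.
    by case: w1 => ->; eexists; reflexivity.
  apply: Or33; exists w'; split; rewrite /= ?Ew //.
  + by case: w1 => E; [left|right]; apply: val_inj; rewrite Ew.
  + by case: w2 => E; [left|right]; apply: val_inj; rewrite Ew.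
Qed.

Lemma maximal_plane_linked (R : realType) (V : finType) (e : rel V) (pi : V -> plane R) :
  symmetric e -> irreflexive e -> (2 < #|V|)%N -> maximal_plane e pi ->
  [/\ joined e, two_joined e & link_connected e].
Proof.
move=> esym eirr V2 mx; have pl := plane_drawing_planar mx.1.
have sat := maximal_plane_saturated mx.
have [a [b [c hull]]] :=
  maximal_hull_triangle esym pl (maximal_plane_extreme_adjacent mx) V2.
have jn := saturated_joined esym pl sat.
have lk := saturated_link_connected esym eirr pl sat hull.
by split=> //; exact: link_two_joined.
Qed.

Lemma bigminn_leq (I : eqType) (r : seq I) (P : pred I) (F : I -> nat) (x : nat) (j : I) :
  j \in r -> P j -> (\big[minn/x]_(i <- r | P i) F i <= F j)%N.
Proof.
elim: r => // i r IH; rewrite inE big_cons => /orP[/eqP <- -> |jr Pj].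
  exact: geq_minl.
by case: ifP => _; [rewrite geq_min IH ?orbT|exact: IH].
Qed.

Lemma fix_drawing_leq (R : realType) (T : finType) (e : rel T) (pi : T -> plane R) :
  (fix_drawing e pi <= #|T|)%N.
Proof. by apply/bigmax_leqP => A _; exact: max_card. Qed.

Lemma fix_points_leq (R : realType) (T : finType) (e : rel T) (pi : T -> plane R) :
  injective pi -> (fix_points e (range pi) <= fix_drawing e pi)%N.
Proof.
move=> inj; have lt : (fix_drawing e pi < #|T|.+1)%N by rewrite ltnS fix_drawing_leq.
rewrite -[X in (_ <= X)%N]/(nat_of_ord (Ordinal lt)) /fix_points.
apply: bigminn_leq; first exact: mem_index_enum.
by apply/asboolP; exists pi.
Qed.

Lemma ex_enumeration (T : finType) (U : pointedType) (X : set U) :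
  (X #= `I_#|T|)%card -> exists2 f : T -> U, injective f & range f = X.
Proof.
rewrite card_eq_sym => /card_set_bijP[g [g1 g2 g3]].
exists (fun t => g (enum_rank t)).
  move=> s t E; apply: enum_rank_inj; apply: val_inj.
  by apply: g2 => //; apply: mem_set; exact: ltn_ord.
apply/seteqP; split => [_ [t _ <-]|x Xx]; first by apply: g1; exact: ltn_ord.
have [i iT <-] := g3 x Xx; exists (enum_val (Ordinal iT)) => //.
by rewrite enum_valK.
Qed.

Lemma FIX_ltn (R : realType) (k m : nat) (T : finType) (e : rel T) :
  (3 <= k)%N -> (0 < m)%N -> in_Hn R k e -> #|T| = (k * k)%N /\
  ((((k * k).+1 ^ (9 * k) * 2 ^ (k * k)) * 2 ^ (k * k) * (k ^ m * (k * k - m)`!)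
    < (k * k)`!)%N -> (FIX R e < m)%N).
Proof.
move=> k3 m0 [[esym eirr] _ [block [pi [_ part cardB mx _]]]].
have /choice [blk blkP] : forall v, exists i, v \in block i.
  by move=> v; have [i [vi _]] := part v; exists i.
have blkE v i : (blk v == i) = (v \in block i).
  apply/eqP/idP => [<- //|vi]; have [j [_ ju]] := part v.
  by rewrite -(ju _ (blkP v)) -(ju _ vi).
have setE i : [set v | blk v == i]%SET = block i.
  by apply/finset.setP => v; rewrite inE blkE.
have cardT : #|T| = (k * k)%N.
  rewrite -sum1_card (partition_big blk predT) //=.
  rewrite (eq_bigr (fun=> k)); first by rewrite sum_nat_const card_ord.
  by move=> i _; rewrite sum1dep_card setE.
split=> //; rewrite -cardT => lt.
have cardV i : (2 < #|{: {x : T | x \in block i}}|)%N by rewrite card_sig cardB.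
have isym i : symmetric (Defs.induced e (block i)) by move=> u v; exact: esym.
have iirr i : irreflexive (Defs.induced e (block i)) by move=> u; exact: eirr.
(* The maximal drawing is used only here; [tri] below holds for every plane drawing. *)
have linked i := maximal_plane_linked (isym i) (iirr i) (cardV i) (mx i).
have jn i (A : pred T) u v : blk u = i -> blk v = i -> A u -> ~~ A v ->
    exists u' v', [/\ blk u' = i, blk v' = i, A u', ~~ A v' & e u' v'].
  move=> /eqP; rewrite blkE => ui /eqP; rewrite blkE => vi Au Av.
  have [jn _ _] := linked i.
  have [u' [v' [Au' Av' euv]]] := jn (A \o val) (exist _ u ui) (exist _ v vi) Au Av.
  by exists (val u'), (val v'); split=> //; apply/eqP; rewrite blkE; exact: valP.
have tri pi' i : plane_drawing e pi' -> exists a b c,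
    block_triangle e (fun x => (pi' x).1 : R) (fun x => (pi' x).2 : R) blk i a b c.
  move=> /plane_drawing_planar/(planar_induced (block i)) pl.
  have [j tj lk] := linked i.
  have [a [b [c [eab ebc eca D0 inn]]]] :=
    linked_hull_triangle (isym i) (iirr i) pl j tj lk (cardV i).
  exists (val a), (val b), (val c); split=> //.
    by split; apply/eqP; rewrite blkE; exact: valP.
  by move=> v /eqP; rewrite blkE => vi; exact: (inn (exist _ v vi)).
have [x0] : exists x0 : T, True.
  have : (0 < #|T|)%N by rewrite cardT muln_gt0 andbb (leq_trans _ k3).
  by case/card_gt0P => x0 _; exists x0.
move=> _; suff le : (FIX R e <= m.-1)%N by rewrite -(prednK m0) ltnS.
apply/bigmax_leqP => l /asboolP[X /ex_enumeration[p0 inj <-] <-].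
pose X0 (t : T) : R := (p0 t).1; pose Y0 (t : T) : R := (p0 t).2.
have [||s sP] := @ex_perm_few_hits T x0 k m blk (decodings k X0 Y0).
- by move=> i; rewrite setE cardB.
- apply: leq_ltn_trans lt; rewrite !leq_mul2r; apply/orP; right; apply/orP; right.
  by have := card_decodings k X0 Y0; rewrite -cardT.
(* Under [p] the point [p0 t] carries the vertex [s t], so a vertex fixed by [p'] is a hit of the
   table [d] at its [t]. *)
pose p v := p0 ((s^-1)%g v).
have injp : injective p by move=> u v /inj /perm_inj.
have -> : range p0 = range p.
  apply/seteqP; split => _ [t _ <-]; last by exists ((s^-1)%g t).
  by exists (s t) => //; rewrite /p permK.
apply: (leq_trans (fix_points_leq e injp)); apply/bigmax_leqP => A /asboolP[p' pd ->].
have pl := plane_drawing_planar pd.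
have [d dD dP] := @decode_block R T k e _ _ X0 Y0 blk pl jn (tri p' ^~ pd).
rewrite -ltnS (prednK m0); apply: leq_ltn_trans (sP d dD).
rewrite -(card_imset _ (@perm_inj _ (s^-1)%g)); apply: subset_leq_card.
apply/fintype.subsetP => t /imsetP[v]; rewrite inE => /eqP Ev ->; rewrite inE permKV.
by apply/eqP; apply: dP; rewrite Ev.
Qed.

(** * Numerical estimates *)

Lemma expn_leq_ffact (n M m : nat) : (m <= M)%N -> ((n - M) ^ m <= n ^_ m)%N.
Proof.
elim: m => [|m IH] mM; first by rewrite expn0 ffactn0.
rewrite expnSr ffactnSr leq_mul ?IH ?leq_sub2l //; exact: ltnW.
Qed.

Lemma square_ltn_exp2 (k : nat) : (5 <= k)%N -> ((k * k).+1 <= 2 ^ k)%N.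
Proof.
elim: k => // k IH; rewrite leq_eqVlt => /orP[/eqP <- //|]; rewrite ltnS => k5.
have := IH k5; rewrite expnS; move: (2 ^ k)%N => q; nia.
Qed.

(** After division by [(n - m)!], the left side is at most [2 ^ (11 n) * k ^ m]: [9 n] from the
    half-planes, since [n + 1 <= 2 ^ k], and [n] each from the order and the set of hits. The
    falling factorial on the right is at least [(n / 2) ^ m], as [2 m <= n]. With [n = k * k] this
    leaves [2 ^ (11 n + m) < k ^ m], which follows from [11 n + m < L m]. *)
Lemma few_decodings (k L m : nat) : (5 <= k)%N -> (2 ^ L <= k)%N -> (0 < L)%N ->
  (11 * (k * k) < L.-1 * m)%N -> (2 * m <= k * k)%N ->
  ((((k * k).+1 ^ (9 * k) * 2 ^ (k * k)) * 2 ^ (k * k) * (k ^ m * (k * k - m)`!)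
    < (k * k)`!)%N).
Proof.
move=> k5 kL L0 m1 m2; set n := (k * k)%N in m1 m2 *.
have mn : (m <= n)%N by apply: leq_trans m2; rewrite leq_pmull.
rewrite -(ffact_fact mn) mulnA ltn_mul2r fact_gt0 /=.
have A : (n.+1 ^ (9 * k) <= 2 ^ (9 * n))%N.
  have -> : (9 * n = k * (9 * k))%N by rewrite /n mulnCA.
  rewrite (expnM 2); case: (posnP (9 * k)%N) => [->|k0]; first by rewrite !expn0.
  by rewrite leq_exp2r //; exact: square_ltn_exp2.
have B : (k ^ m * k ^ m <= 2 ^ m * n ^_ m)%N.
  rewrite -expnMn -/n; apply: (@leq_trans ((2 * (n - m)) ^ m)%N).
    case: (posnP m) => [->|m0]; first by rewrite !expn0.
    by rewrite leq_exp2r // mulnBr; lia.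
  by rewrite expnMn leq_mul2l expn_leq_ffact // orbT.
have C : (2 ^ (11 * n + m) < k ^ m)%N.
  apply: (@leq_trans ((2 ^ L) ^ m)%N); last first.
    case: (posnP m) => [->|m0]; first by rewrite !expn0.
    by rewrite leq_exp2r.
  by rewrite -expnM ltn_exp2l //; case: L L0 {kL} m1 => // L' _ /=; lia.
have k0 : (0 < k ^ m)%N by rewrite expn_gt0 (leq_trans _ k5).
rewrite -(ltn_pmul2l (_ : 0 < 2 ^ m)%N) ?expn_gt0 //; apply: leq_trans B.
apply: (@leq_trans ((2 ^ (11 * n + m)).+1 * k ^ m)%N); last by rewrite leq_mul2r C orbT.
rewrite mulSn -[X in (X < _)%N]add0n -addSn leq_add //.
have -> : (2 ^ (11 * n + m) = 2 ^ m * 2 ^ (9 * n) * 2 ^ n * 2 ^ n)%N.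
  by rewrite -!expnD; congr (2 ^ _)%N; lia.
by clearbody n; rewrite !mulnA; do 4![apply: leq_mul => //]; exact: A.
Qed.

Theorem theorem4p4 (R : realType) :
  exists c0 : R, forall (k n : nat), (3 <= k)%N -> n = (k ^ 2)%N ->
    forall (T : finType) (e : rel T), in_Hn R k e ->
      (FIX R e)%:R <= c0 * (n%:R / ln n%:R).
Proof.
(* With [L] the integer part of the binary logarithm of [k], [ln n = 2 ln k <= 2 (L + 1)]. If
   [L <= 24], the trivial bound [n] gives the constant 50. Otherwise the count gives
   [11 n / (L - 1)], and [L + 1 <= 2 (L - 1)] yields the constant 44. *)
exists 50 => k n k3 -> T e Hn; rewrite -mulnn.
have [cardT _] := FIX_ltn k3 (ltnSn 0) Hn.
pose L := trunc_log 2 k.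
have k0 : (0 < k)%N by exact: leq_trans k3.
have /andP[Lk kL] : (2 ^ L <= k < 2 ^ L.+1)%N by exact: trunc_log_bounds.
have lnk : ln k%:R <= L.+1%:R :> R.
  have k0' : 0 < k%:R :> R by rewrite ltr0n.
  apply: (@le_trans _ _ (ln (2 ^+ L.+1))).
    by rewrite ler_ln ?posrE ?exprn_gt0 // -natrX ler_nat ltnW.
  rewrite lnXn //; apply: ler_wMn2r.
  by rewrite (_ : 2 = 1 + 1 :> R) ?le_ln1Dx //; lra.
have lnk0 : 0 < ln k%:R :> R by rewrite ln_gt0 // ltr1n (leq_trans _ k3).
have lnn : ln (k * k)%:R = 2 * ln k%:R :> R.
  by rewrite natrM lnM ?posrE ?ltr0n // mulr2n mulrDl mul1r.
have n0 : 0 < (k * k)%:R :> R by rewrite ltr0n muln_gt0 k0.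
rewrite mulrA ler_pdivlMr lnn; last by lra.
have [Lsmall|Lbig] := leqP L 24.
  have F : (FIX R e)%:R <= (k * k)%:R :> R.
    by rewrite ler_nat -cardT; apply/bigmax_leqP => i _; rewrite -ltnS ltn_ord.
  have L25 : L.+1%:R <= 25 :> R by rewrite ler_nat.
  rewrite [X in _ <= X]mulrC; apply: ler_pM => //; lra.
(* The count is applied with [m = q.+1]. As [L.-1 >= 24], [q] is at most [11 n / 24], and [n >= 24]
   then gives [2 * q.+1 <= n]. *)
pose q := ((11 * (k * k)) %/ L.-1)%N.
have L1 : (0 < L.-1)%N by lia.
have k5 : (5 <= k)%N.
  by apply: leq_trans Lk; apply: (@leq_trans (2 ^ 3)%N) => //; rewrite leq_exp2l //; lia.
have kk : (24 <= k * k)%N.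
  apply: (@leq_trans k); last by rewrite leq_pmull.
  by apply: leq_trans Lk; apply: (@leq_trans (2 ^ 5)%N) => //; rewrite leq_exp2l //; lia.
have qle : (q * L.-1 <= 11 * (k * k))%N by exact: leq_trunc_div.
have F : (FIX R e <= q)%N.
  have [_ H] := FIX_ltn k3 (ltn0Sn q) Hn; rewrite -ltnS; apply: H.
  apply: (few_decodings (L := L)) => //; first by lia.
    by rewrite [(L.-1 * _)%N]mulnC; exact: ltn_ceil.
  have : (q * 24 <= 11 * (k * k))%N.
    by apply: leq_trans qle; rewrite leq_mul2l; apply/orP; right; lia.
  by clear -kk; lia.
have F' : (FIX R e)%:R * L.-1%:R <= 11 * (k * k)%:R :> R.
  rewrite -!natrM ler_nat; apply: leq_trans qle.
  by rewrite leq_mul2r F orbT.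
have LL : L.+1%:R <= 2 * L.-1%:R :> R by rewrite -natrM ler_nat; lia.
have F0 : 0 <= (FIX R e)%:R :> R by rewrite ler0n.
by nra.
Qed.
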